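(* For every family $(\alpha_k)$ as below, $\mathrm{3SAT}^{\mathrm C}\notin \mathrm{P}^*_{\mathrm{lis}}$ if and only if $\mathrm{3SAT}\notin\mathrm{P/poly}$.
   Context: $\mathbb B=\{T,F\}$. $\mathrm{3SAT}$ is the language of (standardly encoded) satisfiable 3CNF formulas; $\mathrm{P/poly}$ is the usual class of languages decided by polynomial-size circuit families. Let $v_1,v_2,\dots$ be propositional variables. For $k\in\mathbb N$ let $d(k)=\binom{2k}{1}+\binom{2k}{2}+\binom{2k}{3}$, and let $L_k$ be the set of sets $L$ of literals from $\{v_1,\neg v_1,\dots,v_k,\neg v_k\}$ with $1\le |L|\le 3$. Let $(\alpha_k)_{k\in\mathbb N}$ be bijections $\alpha_k:[1,d(k)]\to L_k$ such that (i) for all $i$ and $j\in[1,d(i)]$, $\alpha_{i+1}(j)=\alpha_i(j)$; and (ii) the map $\alpha(i)=\alpha_k(i)$ for the least $k$ with $i\le d(k)$ is polynomial-time computable. For $n\in\mathbb N$ let $k$ be such that $d(k)\le n<d(k+1)$ and define $\mathrm{3SAT}^{\mathrm C}_n:\mathbb B^n\to\mathbb B$ by $\mathrm{3SAT}^{\mathrm C}_n(b_1,\dots,b_n)=T$ iff $\bigwedge_{i\in[1,d(k)],\,b_i=T}\bigvee\alpha_k(i)$ is satisfiable; $\mathrm{3SAT}^{\mathrm C}=(\mathrm{3SAT}^{\mathrm C}_n)_n$. A primitive instruction is one of: a plain basic instruction $a$, a positive test instruction $+a$, a negative test instruction $-a$ (for a basic instruction $a$), a forward jump instruction $\#l$ ($l\in\mathbb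 N$), or the termination instruction $!$. An instruction sequence is a finite nonempty sequence $X=u_1;\dots;u_k$ of primitive instructions; its length is $|X|=k$. Basic instructions have the form $f.m$ where the focus $f$ is one of $\mathrm{in}{:}i$, $\mathrm{aux}{:}i$ ($i\ge 1$) or $\mathrm{out}$, each naming a Boolean register, and the method $m$ is one of $\mathrm{set}{:}T$, $\mathrm{set}{:}F$, $\mathrm{get}$. Executing $f.\mathrm{set}{:}b$ sets register $f$ to $b$ and yields reply $b$; executing $f.\mathrm{get}$ leaves the register unchanged and yields its content as reply. Execution of $X=u_1;\dots;u_k$: a counter starts at $1$. If the counter exceeds $k$, execution deadlocks. At position $i$: if $u_i=!$, execution terminates; if $u_i=\#l$, execution deadlocks if $l=0$ and otherwise the counter becomes $i+l$; if $u_i$ is $a$, $+a$ or $-a$, the basic instruction $a$ is executed yielding reply $r$, and the counter becomes $i+1$ for $u_i=a$; for $u_i=+a$ it becomes $i+1$ if $r=T$ and $i+2$ if $r=F$; for $u_i=-a$ it becomes $i+1$ if $r=F$ and $i+2$ if $r=T$. $\mathrm{IS}_{br}$ is the set of instruction sequences in which every basic instruction occurring belongs to $\{f.\mathrm{get}: f=\mathrm{in}{:}i \text{ or } f=\mathrm{aux}{:}i\}\cup\{f.\mathrm{set}{:}b: f=\mathrm{aux}{:}i \text{ or } f=\mathrm{out},\ b\in\mathbb B\}$. $X\in\mathrm{IS}_{br}$ computes $f:\mathbb B^n\to\mathbb B$ if for every $(b_1,\dots,b_n)\in\mathbb B^n$: when $X$ is executed with register $\mathrm{in}{:}j$ initialised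 to $b_j$ ($j\le n$) and all registers $\mathrm{aux}{:}i$ and $\mathrm{out}$ initialised to $F$, execution terminates without ever executing a basic instruction with focus $\mathrm{in}{:}j$ for $j>n$, and at termination register $\mathrm{out}$ contains $f(b_1,\dots,b_n)$. $\mathrm{P}^*_{\mathrm{lis}}$ is the class of Boolean function families $(f_n)_{n\in\mathbb N}$ ($f_n:\mathbb B^n\to\mathbb B$) for which there is a polynomial $h$ such that for every $n$ there is $X\in\mathrm{IS}_{br}$ computing $f_n$ with $|X|\le h(n)$. *)

(* Defs.v *)
From HB Require Import structures.
From mathcomp Require Import all_boot.
Set Implicit Arguments. Unset Strict Implicit. Unset Printing Implicit Defensive.

(* A literal is a pair (i, s): (i, true) is v_i and (i, false) is ~ v_i.     *)
(* A clause is a list of literals (read as their disjunction), a formula is  *)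
(* a list of clauses (read as their conjunction).                            *)
Definition lit := (nat * bool)%type.

Definition lit_true (a : nat -> bool) (l : lit) : bool := a l.1 == l.2.

Definition satisfiable (phi : seq (seq lit)) : Prop :=
  exists a : nat -> bool, all (fun c => has (lit_true a) c) phi.

Definition is3CNF (phi : seq (seq lit)) : bool :=
  all (fun c => (0 < size c <= 3) && all (fun l => 0 < l.1) c) phi.

(* Standard binary encoding. Binary representation (msb first) of n. *)
Fixpoint bits_fuel (f n : nat) : seq bool :=
  match f with
  | 0 => [::]
  | f'.+1 => if n is 0 then [::] else rcons (bits_fuel f' n./2) (odd n)
  end.
Definition nbits (n : nat) : seq bool := bits_fuel n n.

(* Five symbols 0, 1, NEG, ENDLIT, ENDCLAUSE, each coded by three bits. *)
Definition sym_d (b : bool) : seq bool := [:: false; false; b].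
Definition sym_neg : seq bool := [:: false; true; false].
Definition sym_endlit : seq bool := [:: false; true; true].
Definition sym_endcl : seq bool := [:: true; false; false].

Definition enc_lit (l : lit) : seq bool :=
  (if l.2 then [::] else sym_neg) ++ flatten (map sym_d (nbits l.1)) ++ sym_endlit.
Definition enc_clause (c : seq lit) : seq bool :=
  flatten (map enc_lit c) ++ sym_endcl.
Definition enc_cnf (phi : seq (seq lit)) : seq bool :=
  flatten (map enc_clause phi).

Definition language := seq bool -> Prop.

Definition threeSAT : language :=
  fun w => exists phi, is3CNF phi /\ enc_cnf phi = w /\ satisfiable phi.

(* Wires 0..n-1 are the inputs; gate j is wire n+j and may only use wires    *)
(* with smaller index; the output is the last gate.                          *)
Inductive gate :=
| GConst of bool
| GNot of nat
| GAnd of nat & nat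
| GOr of nat & nat.

Definition gate_ok (m : nat) (g : gate) : bool :=
  match g with
  | GConst _ => true
  | GNot i => i < m
  | GAnd i j | GOr i j => (i < m) && (j < m)
  end.

Definition circuit_ok (n : nat) (gs : seq gate) : bool :=
  (0 < size gs) &&
  all (fun j => gate_ok (n + j) (nth (GConst false) gs j)) (iota 0 (size gs)).

Definition gate_val (w : seq bool) (g : gate) : bool :=
  match g with
  | GConst b => b
  | GNot i => ~~ nth false w i
  | GAnd i j => nth false w i && nth false w j
  | GOr i j => nth false w i || nth false w j
  end.

Definition circ_eval (gs : seq gate) (b : seq bool) : bool :=
  last false (foldl (fun w g => rcons w (gate_val w g)) b gs).

Definition P_poly (L : language) : Prop :=
  exists c : nat, forall n : nat, exists gs : seq gate,
    circuit_ok n gs /\ size gs <= c * n ^ c + c /\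
    forall b : seq bool, size b = n -> (circ_eval gs b = true <-> L b).

Inductive focus := FIn of nat | FAux of nat | FOut.
Inductive meth := MSet of bool | MGet.
Definition basic := (focus * meth)%type.
Inductive prim :=
| PPlain of basic
| PPos of basic
| PNeg of basic
| PJump of nat
| PTerm.

Definition is_br_basic (a : basic) : bool :=
  match a with
  | (FIn i, MGet) => 0 < i
  | (FAux i, _) => 0 < i
  | (FOut, MSet _) => true
  | _ => false
  end.

Definition prim_br (u : prim) : bool :=
  match u with
  | PPlain a | PPos a | PNeg a => is_br_basic a
  | _ => true
  end.

Definition IS_br (X : seq prim) : bool := (0 < size X) && all prim_br X.

Record regs := Regs { r_in : nat -> bool; r_aux : nat -> bool; r_out : bool }.

(* Executing a basic instruction with n input registers; None = access to an
   input register in:j with j > n (forbidden). *)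
Definition exec_basic (n : nat) (a : basic) (r : regs) : option (bool * regs) :=
  match a with
  | (FIn i, MGet) => if 0 < i <= n then Some (r_in r i, r) else None
  | (FIn i, MSet b) =>
      if 0 < i <= n then
        Some (b, Regs (fun j => if j == i then b else r_in r j) (r_aux r) (r_out r))
      else None
  | (FAux i, MGet) => Some (r_aux r i, r)
  | (FAux i, MSet b) =>
      Some (b, Regs (r_in r) (fun j => if j == i then b else r_aux r j) (r_out r))
  | (FOut, MGet) => Some (r_out r, r)
  | (FOut, MSet b) => Some (b, Regs (r_in r) (r_aux r) b)
  end.

(* Run pc r: running at counter pc; Halt r: terminated; Fail: deadlock or
   forbidden input access. *)
Inductive outcome := Run of nat & regs | Halt of regs | Fail.

Definition step (n : nat) (X : seq prim) (pc : nat) (r : regs) : outcome :=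
  if (pc == 0) || (size X < pc) then Fail else
  match nth PTerm X pc.-1 with
  | PTerm => Halt r
  | PJump l => if l == 0 then Fail else Run (pc + l) r
  | PPlain a =>
      if exec_basic n a r is Some (_, r') then Run pc.+1 r' else Fail
  | PPos a =>
      if exec_basic n a r is Some (rep, r') then
        Run (if rep then pc.+1 else pc.+2) r' else Fail
  | PNeg a =>
      if exec_basic n a r is Some (rep, r') then
        Run (if rep then pc.+2 else pc.+1) r' else Fail
  end.

Fixpoint run (n : nat) (X : seq prim) (t : nat) (o : outcome) : outcome :=
  match t with
  | 0 => o
  | t'.+1 => if o is Run pc r then run n X t' (step n X pc r) else o
  end.

Definition init_regs (b : seq bool) : regs :=
  Regs (fun j => nth false b j.-1) (fun _ => false) false.

(* A Boolean function B^n -> B is given as a predicate on bit strings of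
   length n (its value is T iff the predicate holds). *)
Definition IS_computes (n : nat) (X : seq prim) (f : seq bool -> Prop) : Prop :=
  forall b : seq bool, size b = n ->
    exists (t : nat) (r : regs),
      run n X t (Run 1 (init_regs b)) = Halt r /\ (r_out r = true <-> f b).

Definition P_lis (F : nat -> seq bool -> Prop) : Prop :=
  exists c : nat, forall n : nat, exists X : seq prim,
    IS_br X /\ size X <= c * n ^ c + c /\ IS_computes n X (F n).

(* Sets of literals are represented by duplicate-free lists, compared with   *)
(* =i (same elements).                                                       *)
Definition dd (k : nat) : nat := 'C(k.*2, 1) + 'C(k.*2, 2) + 'C(k.*2, 3).

Definition in_Lk (k : nat) (s : seq lit) : bool :=
  uniq s && (0 < size s <= 3) && all (fun l => 0 < l.1 <= k) s.

Definition alpha_bij (k : nat) (ak : nat -> seq lit) : Prop :=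
  (forall j, 0 < j <= dd k -> in_Lk k (ak j)) /\
  (forall j j', 0 < j <= dd k -> 0 < j' <= dd k -> ak j =i ak j' -> j = j') /\
  (forall s, in_Lk k s -> exists j, 0 < j <= dd k /\ ak j =i s).

Definition alpha_consistent (alphas : nat -> nat -> seq lit) : Prop :=
  forall i j, 0 < j <= dd i -> alphas i.+1 j =i alphas i j.

(* Single-tape Turing machines over {0,1,blank} (blank = None). *)
Inductive dir := DL | DR | DS.
Record TM := MkTM {
  tm_Q : nat;
  tm_delta : 'I_tm_Q.+1 -> option bool -> option ('I_tm_Q.+1 * option bool * dir)
}.
Record tape := Tape { tl : seq (option bool); th : option bool; tr : seq (option bool) }.

Definition move (d : dir) (t : tape) : tape :=
  match d with
  | DS => t
  | DL => if tl t is x :: l then Tape l x (th t :: tr t) else Tape [::] None (th t :: tr t)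
  | DR => if tr t is x :: r then Tape (th t :: tl t) x r else Tape (th t :: tl t) None [::]
  end.

Fixpoint tm_run (M : TM) (f : nat) (q : 'I_(tm_Q M).+1) (t : tape) : option tape :=
  match f with
  | 0 => None
  | f'.+1 =>
      match tm_delta q (th t) with
      | None => Some t
      | Some (q', s, d) => tm_run f' q' (move d (Tape (tl t) s (tr t)))
      end
  end.

Definition tape_in (x : seq bool) : tape :=
  if x is a :: r then Tape [::] (Some a) (map Some r) else Tape [::] None [::].

Fixpoint somes (s : seq (option bool)) : seq bool :=
  if s is Some b :: s' then b :: somes s' else [::].
Definition tape_out (t : tape) : seq bool := somes (th t :: tr t).

(* condition (ii): i |-> alpha(i) = alpha_k(i) (k least with i <= d(k)) is
   polynomial-time computable: input i in binary, output the encoding of a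
   duplicate-free list of the literals of alpha(i). *)
Definition alpha_polytime (alphas : nat -> nat -> seq lit) : Prop :=
  exists (M : TM) (c : nat), forall i k,
    0 < i -> i <= dd k -> (forall k', k' < k -> dd k' < i) ->
    exists (t : tape) (s : seq lit),
      tm_run (M := M) (c * size (nbits i) ^ c + c) ord0 (tape_in (nbits i)) = Some t /\
      tape_out t = enc_clause s /\ uniq s /\ s =i alphas k i.

Definition threeSATC (alphas : nat -> nat -> seq lit) (n : nat) (b : seq bool) : Prop :=
  exists k, dd k <= n < dd k.+1 /\
    satisfiable [seq alphas k i | i <- iota 1 (dd k) & nth false b i.-1].

(* Main.v *)
Require Import Defs.
From HB Require Import structures.
From mathcomp Require Import all_boot.
From mathcomp Require Import zify.
Set Implicit Arguments. Unset Strict Implicit. Unset Printing Implicit Defensive.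

(* Both classes are nonuniform, so only finitely many values of (alpha_k)
   matter for each input length. From circuits for 3SAT to instruction
   sequences: the formula selected by b_1, ..., b_n can be encoded so that
   every bit of the encoding depends on a single b_i, since deselected clauses
   can be replaced by trivially satisfiable ones with codes of equal length;
   circuits are then straight-line programs. Conversely, a 3CNF code of 3m bits
   has at most m literal occurrences. Giving each occurrence its own variable,
   linked by implications to the other occurrences of the same original
   variable, yields an equisatisfiable formula over v_1, ..., v_m, whose
   selection bits are small formulas in the input bits; as jumps only go
   forward, an instruction sequence unrolls into a circuit that decides it. *)

(** * Polynomial bounds, clause counts and binary representations *)

(** To decide codes of 3m bits, the family is queried at the single length d(m), where the index k
    is m itself and every input bit selects a clause. The obstacle is that such a code may name
    variables whose numbers are exponential in m, far outside v_1, ..., v_m. Renaming an occurrence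
    by its position, rather than by its rank, needs no counting: the new literal is fixed by the
    index of its ENDLIT symbol and one sign bit. It also makes the literals of a clause distinct, so
    lists with repetitions become sets of the same size and the bound of three literals can be
    tested by membership in L_m. Digit strings are never stored in a circuit; they are only compared
    with each other, by walking left from two positions at once. *)

Definition poly_bounded (f : nat -> nat) : Prop :=
  exists c, forall n, f n <= (n + 2) ^ c.

Lemma poly_bounded_leq f g :
  (forall n, f n <= g n) -> poly_bounded g -> poly_bounded f.
Proof. by move=> fg [c Hc]; exists c => n; apply: leq_trans (Hc n). Qed.

Lemma poly_bounded_const c : poly_bounded (fun=> c).
Proof.
exists c => n; apply: (@leq_trans (2 ^ c)); first exact/ltnW/ltn_expl.
by case: c => // c; rewrite leq_exp2r // leq_addl.
Qed.

Lemma poly_bounded_id : poly_bounded id.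
Proof. by exists 1 => n; rewrite leq_addr. Qed.

Lemma poly_bounded_mul f g :
  poly_bounded f -> poly_bounded g -> poly_bounded (fun n => f n * g n).
Proof.
by move=> [c Hc] [d Hd]; exists (c + d) => n; rewrite expnD leq_mul.
Qed.

(** The base n + 2 is at least 2, so one extra factor absorbs the sum of two powers. *)
Lemma poly_bounded_add f g :
  poly_bounded f -> poly_bounded g -> poly_bounded (fun n => f n + g n).
Proof.
move=> [c Hc] [d Hd]; exists (maxn c d).+1 => n.
rewrite expnS; apply: (@leq_trans (2 * (n + 2) ^ maxn c d)); last first.
  by rewrite leq_mul2r leq_addl orbT.
rewrite mul2n -addnn leq_add //.
  by apply: leq_trans (Hc n) _; rewrite leq_pexp2l ?leq_maxl ?addn2.
by apply: leq_trans (Hd n) _; rewrite leq_pexp2l ?leq_maxr ?addn2.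
Qed.

Lemma poly_bounded_exp f c :
  poly_bounded f -> poly_bounded (fun n => f n ^ c).
Proof.
move=> [d Hd]; exists (d * c) => n; rewrite expnM.
by case: c => // c; rewrite leq_exp2r.
Qed.

Lemma poly_boundedP f :
  poly_bounded f <-> exists c, forall n, f n <= c * n ^ c + c.
Proof.
split=> [[c Hc]|[c Hc]].
(* For n > 0 we have n + 2 <= 3 * n; the additive constant covers n = 0. *)
- exists (3 ^ c) => n; apply: leq_trans (Hc n) _.
  have lec : c <= 3 ^ c by apply/ltnW/ltn_expl.
  case: n => [|n]; first by case: c {Hc lec} => // c; rewrite (leq_trans _ (leq_addl _ _)) // leq_exp2r.
  apply: leq_trans (leq_addr _ _).
  apply: (@leq_trans ((3 * n.+1) ^ c)).
    by case: c {Hc lec} => // c; rewrite leq_exp2r //; lia.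
  by rewrite expnMn leq_mul2l leq_pexp2l // orbT.
- apply: (poly_bounded_leq Hc); apply: poly_bounded_add; last exact: poly_bounded_const.
  apply: poly_bounded_mul; first exact: poly_bounded_const.
  exact: poly_bounded_exp poly_bounded_id.
Qed.

Lemma ddS k : dd k < dd k.+1.
Proof.
rewrite /dd !doubleS !bin1.
have h2 : 'C(k.*2, 2) <= 'C(k.*2.+2, 2) by apply: leq_bin2l; lia.
have h3 : 'C(k.*2, 3) <= 'C(k.*2.+2, 3) by apply: leq_bin2l; lia.
by lia.
Qed.

Lemma ltn_dd k k' : k < k' -> dd k < dd k'.
Proof. by apply: (homo_ltn ltn_trans) => i; apply: ddS. Qed.

Lemma dd_mono k k' : k <= k' -> dd k <= dd k'.
Proof. by rewrite leq_eqVlt => /predU1P[->//|/ltn_dd/ltnW]. Qed.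

Lemma leq_dd k : k <= dd k.
Proof. by elim: k => // k IHk; apply: leq_ltn_trans IHk (ddS k). Qed.

Lemma dd_interval_uniq k k' n :
  dd k <= n < dd k.+1 -> dd k' <= n < dd k'.+1 -> k = k'.
Proof.
move=> /andP[h1 h2] /andP[h3 h4]; have [lt_kk'|lt_k'k|//] := ltngtP k k'.
  by have := dd_mono lt_kk'; lia.
by have := dd_mono lt_k'k; lia.
Qed.

Lemma dd_interval n : exists k, dd k <= n < dd k.+1.
Proof.
elim: n => [|n [k /andP[h1 h2]]]; first by exists 0.
have [le_n|lt_n] := leqP (dd k.+1) n.+1.
  by exists k.+1; rewrite le_n (leq_ltn_trans h2) // ddS.
by exists k; rewrite lt_n (leqW h1).
Qed.

Lemma poly_bounded_dd : poly_bounded dd.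
Proof.
have Hd : poly_bounded (fun k => k.*2).
  apply: (@poly_bounded_leq _ (fun k => k + k)) => [k|]; first by rewrite addnn.
  by apply: poly_bounded_add; apply: poly_bounded_id.
have Hb j : poly_bounded (fun k => 'C(k.*2, j)).
  apply: (@poly_bounded_leq _ (fun k => k.*2 ^ j)) => [k|]; last exact: poly_bounded_exp.
  apply: (@leq_trans (k.*2 ^_ j)); last by rewrite ffact_prod -[X in _ ^ X]card_ord -prod_nat_const leq_prod // => i _; rewrite leq_subr.
  by rewrite -bin_ffact leq_pmulr // fact_gt0.
by apply: poly_bounded_add => //; apply: poly_bounded_add.
Qed.

Definition bits_val (s : seq bool) : nat := foldl (fun v (b : bool) => v.*2 + b) 0 s.

Lemma bits_val_rcons s b : bits_val (rcons s b) = (bits_val s).*2 + b.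
Proof. by rewrite /bits_val foldl_rcons. Qed.

Lemma bits_val_fuel f n : n <= f -> bits_val (bits_fuel f n) = n.
Proof.
elim: f n => [|f IHf] [|n] //= le_n.
rewrite bits_val_rcons IHf; last by lia.
by rewrite addnC -[RHS]odd_double_half.
Qed.

Lemma nbitsK : cancel nbits bits_val.
Proof. by move=> n; apply: bits_val_fuel. Qed.

Lemma bits_fuel_cat f n (b : bool) : 0 < n -> n.*2 + b <= f ->
  bits_fuel f (n.*2 + b) = rcons (bits_fuel f.-1 n) b.
Proof.
move=> n_gt0; case: f => [|f] le_f; first by lia.
rewrite /=; case E : (n.*2 + b) => [|k]; first by lia.
have -> : (k.+1)./2 = n by lia.
by have -> : odd k.+1 = b by lia.
Qed.

Lemma bits_fuel_irr f f' n : n <= f -> n <= f' -> bits_fuel f n = bits_fuel f' n.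
Proof.
elim: f f' n => [|f IHf] [|f'] [|n] //= h h'.
by rewrite (IHf f') //; lia.
Qed.

Lemma nbits_double n (b : bool) : 0 < n -> nbits (n.*2 + b) = rcons (nbits n) b.
Proof.
move=> n_gt0; rewrite /nbits bits_fuel_cat //.
by congr rcons; apply: bits_fuel_irr; lia.
Qed.

Lemma bits_val_gt0 d : 0 < bits_val (true :: d).
Proof. by elim/last_ind: d => // d b IHd; rewrite -rcons_cons bits_val_rcons; lia. Qed.

(** Numerals of positive numbers are thus exactly the digit strings with leading 1, a condition that
    can be checked symbol by symbol. *)
Lemma bits_valK d : nbits (bits_val (true :: d)) = true :: d.
Proof.
elim/last_ind: d => // d b IHd.
by rewrite -rcons_cons bits_val_rcons nbits_double ?bits_val_gt0 ?IHd.
Qed.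

Lemma nbits_pos n : 0 < n -> exists d, nbits n = true :: d.
Proof.
elim/ltn_ind: n => n IHn n_gt0; have [n_le1|n_gt1] := leqP n 1.
  by exists [::]; have -> : n = 1 by lia.
have [|//|d Ed] := IHn n./2; try lia.
exists (rcons d (odd n)).
have {1}-> : n = (n./2).*2 + odd n by lia.
by rewrite nbits_double ?Ed //; lia.
Qed.

Lemma size_nbits_pow2 m j : j < 2 ^ m -> size (nbits (2 ^ m + j)) = m.+1.
Proof.
elim: m j => [|m IHm] j; first by case: j.
rewrite expnS => lt_j.
have -> : 2 * 2 ^ m + j = (2 ^ m + j./2).*2 + odd j.
  by lia.
have pos : 0 < 2 ^ m by rewrite expn_gt0.
by rewrite nbits_double ?size_rcons ?IHm //; lia.
Qed.

(** * Straight-line instruction sequences *)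

(* [Cmd f s g v] stands for "if f = s then g := v". *)
Record cmd := Cmd { c_src : focus; c_sign : bool; c_tgt : focus; c_val : bool }.

Definition cmd_code (c : cmd) : seq prim :=
  [:: (if c_sign c then PPos else PNeg) (c_src c, MGet);
      PPlain (c_tgt c, MSet (c_val c))].

Definition read_reg (r : regs) (f : focus) : bool :=
  match f with FIn i => r_in r i | FAux i => r_aux r i | FOut => r_out r end.

Definition write_reg (r : regs) (f : focus) (v : bool) : regs :=
  match f with
  | FIn i => Regs (fun j => if j == i then v else r_in r j) (r_aux r) (r_out r)
  | FAux i => Regs (r_in r) (fun j => if j == i then v else r_aux r j) (r_out r)
  | FOut => Regs (r_in r) (r_aux r) v
  end.

Definition cmd_exec (r : regs) (c : cmd) : regs :=
  if read_reg r (c_src c) == c_sign c then write_reg r (c_tgt c) (c_val c) else r.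

Definition cmd_ok (n : nat) (c : cmd) : bool :=
  match c_src c with FIn i => 0 < i <= n | FAux i => 0 < i | FOut => false end
  && match c_tgt c with FIn _ => false | FAux i => 0 < i | FOut => true end.

Lemma cmd_code_br n c : cmd_ok n c -> all prim_br (cmd_code c).
Proof.
case: c => [f s g v]; rewrite /cmd_ok /cmd_code /=.
by case: f => [i|i|]; case: g => [j|j|]; case: s => //= /andP[]; case: i => // ? _; case: j.
Qed.

(** The prefix [pre] grows along the induction, so the whole program stays fixed while the counter
    advances. A command takes two positions: its test either falls through to the assignment or
    skips it. *)
Lemma run_cmds n cs pre r : all (cmd_ok n) cs ->
  exists t, run n (pre ++ flatten (map cmd_code cs) ++ [:: PTerm]) t
              (Run (size pre).+1 r) = Halt (foldl cmd_exec r cs).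
Proof.
elim: cs pre r => [|c cs IHcs] pre r /=.
  by move=> _; exists 1; rewrite /= /step size_cat /= addn1 ltnn /= nth_cat ltnn subnn.
case/andP=> ok_c /(IHcs (pre ++ cmd_code c)) IH; set X := pre ++ _.
have {IH} : forall r', exists t,
  run n X t (Run (size pre).+3 r') = Halt (foldl cmd_exec r' cs).
  by move=> r'; have [t] := IH r'; rewrite -catA size_cat addnC; exists t.
have nth0 : nth PTerm X (size pre) = (if c_sign c then PPos else PNeg) (c_src c, MGet).
  by rewrite nth_cat ltnn subnn.
have nth1 : nth PTerm X (size pre).+1 = PPlain (c_tgt c, MSet (c_val c)).
  by rewrite nth_cat ltnNge leqnSn subSnn.
have sX : size X = (size (flatten (map cmd_code cs)) + 3) + size pre.
  by rewrite size_cat /= size_cat /= ; lia.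
have step0 : step n X (size pre).+1 r =
    Run (if read_reg r (c_src c) == c_sign c then (size pre).+2 else (size pre).+3) r.
  rewrite /step ltnNge sX /= nth0; move: ok_c; rewrite /cmd_ok.
  have -> : size pre < size (flatten [seq cmd_code i | i <- cs]) + 3 + size pre by lia.
  case: (c_sign c) (c_src c) => [] [i|i|] //= /andP[src_ok _]; rewrite ?src_ok ?eqb_id //=.
    by case: (r_in r i).
  by case: (r_aux r i).
have step1 : step n X (size pre).+2 r = Run (size pre).+3 (write_reg r (c_tgt c) (c_val c)).
  rewrite /step ltnNge sX /= nth1; move: ok_c; rewrite /cmd_ok.
  have -> : (size pre).+1 < size (flatten [seq cmd_code i | i <- cs]) + 3 + size pre by lia.
  by case: (c_tgt c) => [i|i|] //= /andP[].
move=> IH; rewrite /cmd_exec; have [t Ht] := IH (cmd_exec r c).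
move: Ht; rewrite /cmd_exec; case: ifP => Er Ht.
  by exists t.+2; rewrite /= step0 Er /= step1.
by exists t.+1; rewrite /= step0 Er.
Qed.

(** The target register is fresh and still contains F, so only the cases that change it need a
    command. A constant has no source wire and therefore tests its own target. *)
Definition gate_cmds (t : nat) (g : gate) : seq cmd :=
  let T := FAux t.+1 in
  match g with
  | GConst b => [:: Cmd T true T b; Cmd T false T b]
  | GNot i => [:: Cmd (FAux i.+1) false T true]
  | GAnd i j => [:: Cmd (FAux i.+1) true T true; Cmd (FAux j.+1) false T false]
  | GOr i j => [:: Cmd (FAux i.+1) true T true; Cmd (FAux j.+1) true T true]
  end.

(** A triple [(i, x, y)] is an arbitrary function of the one bit b_i: x if it is T, y if it is F. *)
Definition proj_cmds (t : nat) (p : nat * bool * bool) : seq cmd :=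
  let T := FAux t.+1 in
  [:: Cmd (FIn p.1.1) true T p.1.2; Cmd (FIn p.1.1) false T p.2].

(* Register [aux:i+1] holds wire [i]; registers not yet used still hold F. *)
Definition holds (b ws : seq bool) (r : regs) : Prop :=
  [/\ r_in r = (fun j => nth false b j.-1),
      (forall i, r_aux r i.+1 = nth false ws i) & r_out r = false].

Lemma gate_cmdsP b ws r g : gate_ok (size ws) g -> holds b ws r ->
  holds b (rcons ws (gate_val ws g)) (foldl cmd_exec r (gate_cmds (size ws) g)).
Proof.
case: r => ri ra ro ok_g [/= Ei Ea Eo].
have Et : ra (size ws).+1 = false by rewrite Ea nth_default.
have neq i : i < size ws -> (i.+1 == (size ws).+1) = false by lia.
have Ef i v : nth false (rcons ws v) i = if i == size ws then v else ra i.+1.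
  rewrite nth_rcons Ea; case: ltngtP => // lt_i.
  by rewrite nth_default // ltnW.
case: g ok_g => [v|i|i j|i j] /=; rewrite /cmd_exec /=.
- by rewrite Et /= Et /=; split=> //= i; rewrite Ef.
- by rewrite !Ea => ok_i; case E : (nth false ws i); split=> //= j; rewrite Ef //=; case: eqP => // ->; by rewrite ?Et.
- case/andP=> ok_i ok_j; rewrite !Ea.
  case E : (nth false ws i) => /=; rewrite ?neq // Ea; case E' : (nth false ws j) => /=;
    split=> //= k; rewrite Ef ?eqSS; case: eqP => // ->; by rewrite ?Et.
- case/andP=> ok_i ok_j; rewrite !Ea.
  case E : (nth false ws i) => /=; rewrite ?neq // Ea; case E' : (nth false ws j) => /=;
    split=> //= k; rewrite Ef ?eqSS; case: eqP => // ->; by rewrite ?Et.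
Qed.

Definition proj_val (b : seq bool) (p : nat * bool * bool) : bool :=
  if nth false b p.1.1.-1 then p.1.2 else p.2.

Lemma proj_cmdsP b ws r p : holds b ws r ->
  holds b (rcons ws (proj_val b p)) (foldl cmd_exec r (proj_cmds (size ws) p)).
Proof.
case: r p => ri ra ro [[i x] y] [/= Ei Ea Eo].
have Ef j v : nth false (rcons ws v) j = if j == size ws then v else ra j.+1.
  rewrite nth_rcons Ea; case: ltngtP => // lt_j.
  by rewrite nth_default // ltnW.
rewrite /cmd_exec /proj_val /= !Ei.
by case E : (nth false b i.-1); rewrite /= ?Ei ?E /=; split=> //= j; rewrite Ef.
Qed.

Fixpoint cmds_from (A : Type) (f : nat -> A -> seq cmd) (t : nat) (s : seq A) : seq cmd :=
  if s is x :: s' then f t x ++ cmds_from f t.+1 s' else [::].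

Lemma proj_cmds_holds b ws r ps : holds b ws r ->
  holds b (ws ++ map (proj_val b) ps) (foldl cmd_exec r (cmds_from proj_cmds (size ws) ps)).
Proof.
elim: ps ws r => [|p ps IHps] ws r Hr; first by rewrite cats0.
rewrite map_cons -cat_rcons.
rewrite -[cmds_from _ _ _]/(proj_cmds _ _ ++ cmds_from _ _ _) foldl_cat.
rewrite -(size_rcons ws (proj_val b p)).
exact/IHps/proj_cmdsP.
Qed.

Lemma gate_cmds_holds b ws r gs :
  (forall j, j < size gs -> gate_ok (size ws + j) (nth (GConst false) gs j)) ->
  holds b ws r ->
  holds b (foldl (fun w g => rcons w (gate_val w g)) ws gs)
    (foldl cmd_exec r (cmds_from gate_cmds (size ws) gs)).
Proof.
elim: gs ws r => [|g gs IHgs] ws r // ok_gs Hr.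
have ok_g := ok_gs 0 isT; rewrite addn0 in ok_g.
rewrite /= foldl_cat -(size_rcons ws (gate_val ws g)).
apply: IHgs; last exact: gate_cmdsP.
by move=> j lt_j; rewrite size_rcons addSnnS; apply: ok_gs.
Qed.

Lemma size_wires gs ws :
  size (foldl (fun w g => rcons w (gate_val w g)) ws gs) = size ws + size gs.
Proof. by elim: gs ws => [|g gs IHgs] ws /=; rewrite ?addn0 // IHgs size_rcons addSnnS. Qed.

Lemma gate_cmds_ok n t g : gate_ok t g -> all (cmd_ok n) (gate_cmds t g).
Proof. by case: g => [v|i|i j|i j]. Qed.

Lemma cmds_from_ok n A (f : nat -> A -> seq cmd) (x0 : A) t s :
  (forall j, j < size s -> all (cmd_ok n) (f (t + j) (nth x0 s j))) ->
  all (cmd_ok n) (cmds_from f t s).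
Proof.
elim: s t => [|x s IHs] t // ok_s; rewrite /= all_cat.
have := ok_s 0 isT; rewrite addn0 => -> /=.
by apply: IHs => j lt_j; rewrite addSnnS; apply: ok_s.
Qed.

Lemma size_cmds_from A (f : nat -> A -> seq cmd) t s k :
  (forall t x, size (f t x) <= k) -> size (cmds_from f t s) <= k * size s.
Proof.
by move=> le_k; elim: s t => [|x s IHs] t //=; rewrite size_cat mulnS leq_add.
Qed.

Lemma size_gate_cmds t g : size (gate_cmds t g) <= 2.
Proof. by case: g. Qed.

(** Each wire costs at most two commands of two instructions; copying the output and terminating
    adds three. *)
Lemma IS_of_circuit n gs ps :
  all (fun p => 0 < p.1.1 <= n) ps -> circuit_ok (size ps) gs ->
  exists X, [/\ IS_br X, size X <= 4 * (size ps + size gs) + 3 &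
    IS_computes n X (fun b => circ_eval gs (map (proj_val b) ps))].
Proof.
move=> ok_ps /andP[gs_gt0 ok_gs].
(* Wire i sits in register [aux:i+1], so this is the last wire. Register [out] starts as F, hence
   only T has to be copied. *)
pose out := Cmd (FAux (size ps + size gs)) true FOut true.
pose cs := (cmds_from proj_cmds 0 ps ++ cmds_from gate_cmds (size ps) gs) ++ [:: out].
have gs_okj j : j < size gs -> gate_ok (size ps + j) (nth (GConst false) gs j).
  by move=> lt_j; have := allP ok_gs j; rewrite mem_iota; apply.
have cs_ok : all (cmd_ok n) cs.
  rewrite /cs !all_cat /=; apply/and3P; split.
  - apply/andP; split; last by apply: cmds_from_ok => j /gs_okj; apply: gate_cmds_ok.
    apply: (@cmds_from_ok _ _ _ (0, false, false)) => j lt_j.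
    by have := allP ok_ps _ (mem_nth (0, false, false) lt_j); rewrite /cmd_ok /= => ->.
  - by rewrite /cmd_ok /= ; lia.
  - by [].
exists (flatten (map cmd_code cs) ++ [:: PTerm]); split.
- rewrite /IS_br size_cat addn1 /= all_cat andbT.
  elim: (cs) cs_ok => //= c s IHs /andP[/cmd_code_br ok_c /IHs ok_s].
  by move: ok_c; rewrite /cmd_code /= !andbT => /andP[-> ->].
- have sc s : size (flatten (map cmd_code s)) = 2 * size s.
    by elim: s => //= c s /= ->; lia.
  rewrite size_cat sc /cs !size_cat /=.
  have := @size_cmds_from _ gate_cmds (size ps) gs 2 size_gate_cmds.
  have := @size_cmds_from _ proj_cmds 0 ps 2 (fun _ _ => leqnn 2).
  lia.
- move=> b sz_b; have [t Ht] := @run_cmds n cs [::] (init_regs b) cs_ok.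
  exists t; eexists; split; first exact: Ht.
  have H0 : holds b [::] (init_regs b) by split=> // i; rewrite nth_nil.
  have := @proj_cmds_holds _ _ _ ps H0; rewrite cat0s /= => H1.
  have szp : size (map (proj_val b) ps) = size ps by rewrite size_map.
  have := @gate_cmds_holds _ _ _ gs _ H1; rewrite szp => /(_ gs_okj)[Hi Ha Ho].
  rewrite /cs !foldl_cat /= {1}/cmd_exec /circ_eval -nth_last size_wires szp.
  have Ea : size ps + size gs = (size ps + size gs).-1.+1 by lia.
  by rewrite /= Ea Ha /= eqb_id; case: ifP => // _; rewrite Ho.
Qed.

(** * Scanning encoded formulas *)

Definition syms_lit (l : lit) : seq (seq bool) :=
  (if l.2 then [::] else [:: sym_neg]) ++ map sym_d (nbits l.1) ++ [:: sym_endlit].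
Definition syms_clause (c : seq lit) : seq (seq bool) :=
  flatten (map syms_lit c) ++ [:: sym_endcl].
Definition syms_cnf (phi : seq (seq lit)) : seq (seq bool) :=
  flatten (map syms_clause phi).

Lemma flatten_flatten (T : Type) (sss : seq (seq (seq T))) :
  flatten (flatten sss) = flatten (map flatten sss).
Proof. by elim: sss => //= ss sss IH; rewrite flatten_cat IH. Qed.

Lemma flatten_syms_clause c : flatten (syms_clause c) = enc_clause c.
Proof.
rewrite /syms_clause flatten_cat /= flatten_flatten -map_comp; congr (flatten _ ++ _).
apply: eq_map => -[v s]; rewrite /= /syms_lit /enc_lit !flatten_cat /=.
by case: s.
Qed.

Lemma flatten_syms_cnf phi : flatten (syms_cnf phi) = enc_cnf phi.
Proof.
rewrite flatten_flatten -map_comp; congr flatten; apply: eq_map.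
exact: flatten_syms_clause.
Qed.

Lemma size_syms_cnf phi x : x \in syms_cnf phi -> size x = 3.
Proof.
case/flattenP=> _ /mapP[c _ ->]; rewrite mem_cat inE => /orP[|/eqP->//].
case/flattenP=> _ /mapP[l _ ->]; rewrite !mem_cat !inE.
case/or3P=> [|/mapP[d _ ->]//|/eqP->//].
by case: (l.2) => //; rewrite inE => /eqP->.
Qed.

Definition sym_at (w : seq bool) (p : nat) : seq bool :=
  [:: nth false w (3 * p); nth false w (3 * p).+1; nth false w (3 * p).+2].

Lemma flatten_sym_at w m : size w = 3 * m -> flatten (mkseq (sym_at w) m) = w.
Proof.
elim: m w => [|m IHm] w; first by rewrite muln0 => /size0nil->.
rewrite mulnS; case: w => [|a [|b [|c w]]] // [sz_w].
have -> : mkseq (sym_at [:: a, b, c & w]) m.+1 = [:: a; b; c] :: mkseq (sym_at w) m.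
  rewrite /mkseq -(addn1 m) addnC iotaD map_cat /= (iotaDl 1 0) -map_comp.
  by congr (_ :: _); apply: eq_map => p; rewrite /= /sym_at mulnDr.
by rewrite /= IHm.
Qed.

(** Blocks of constant length 3 leave only one way to cut a bit string. *)
Lemma flatten_shape3_inj (ss ss' : seq (seq bool)) :
  (forall x, x \in ss -> size x = 3) -> (forall x, x \in ss' -> size x = 3) ->
  flatten ss = flatten ss' -> ss = ss'.
Proof.
have shape3 s : (forall x, x \in s -> size x = 3) -> shape s = nseq (size s) 3.
  elim: s => //= x s IHs Hs; rewrite Hs ?mem_head // IHs // => y s_y.
  by apply: Hs; rewrite inE s_y orbT.
move=> /shape3 E /shape3 E' eq_ss; apply: eq_from_flatten_shape => //.
have := congr1 size eq_ss; rewrite !size_flatten E E' !sumn_nseq => sz.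
by congr nseq; lia.
Qed.

Lemma syms_cnf_sym_at phi w m : size w = 3 * m ->
  enc_cnf phi = w <-> syms_cnf phi = mkseq (sym_at w) m.
Proof.
move=> sz_w; split=> [eq_w|eq_s]; last by rewrite -flatten_syms_cnf eq_s flatten_sym_at.
apply: flatten_shape3_inj; first exact: size_syms_cnf.
  by move=> x /mapP[p _ ->].
by rewrite flatten_sym_at // flatten_syms_cnf.
Qed.

(* A left-to-right scanner. The literal read at an ENDLIT in position p is
   recorded as (p, (sign, digits)). *)
Record scan := Scan {
  s_pos : nat; s_neg : bool; s_dig : seq bool;
  s_cur : seq (nat * (bool * seq bool));
  s_out : seq (seq (nat * (bool * seq bool))) }.

Definition scan0 := Scan 0 false [::] [::] [::].

Definition is_dig (x : seq bool) : bool := (x == sym_d false) || (x == sym_d true).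

Definition scan_step (s : scan) (x : seq bool) : scan :=
  let: Scan p ng dg cur out := s in
  if x == sym_neg then Scan p.+1 true [::] cur out
  else if is_dig x then Scan p.+1 ng (rcons dg (x == sym_d true)) cur out
  else if x == sym_endlit then Scan p.+1 false [::] (rcons cur (p, (~~ ng, dg))) out
  else if x == sym_endcl then Scan p.+1 false [::] [::] (rcons out cur)
  else Scan p.+1 false [::] cur out.

Definition lit_key (l : lit) : bool * seq bool := (l.2, nbits l.1).

Lemma scan_digits p ng dg cur out d :
  foldl scan_step (Scan p ng dg cur out) (map sym_d d) =
  Scan (p + size d) ng (dg ++ d) cur out.
Proof.
elim: d p dg => [|b d IHd] p dg; first by rewrite addn0 cats0.
rewrite /= -cat_rcons addnS -addSn -IHd /scan_step; congr foldl.
by case: b.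
Qed.

Lemma scan_lit p cur out l :
  exists q p', foldl scan_step (Scan p false [::] cur out) (syms_lit l) =
    Scan q false [::] (rcons cur (p', lit_key l)) out.
Proof.
case: l => v s; rewrite /syms_lit foldl_cat foldl_cat /=.
by case: s; do 2!eexists; rewrite /= scan_digits /=.
Qed.

Lemma scan_lits p cur out c :
  exists q cur', foldl scan_step (Scan p false [::] cur out) (flatten (map syms_lit c)) =
    Scan q false [::] (cur ++ cur') out /\ map snd cur' = map lit_key c.
Proof.
elim: c p cur => [|l c IHc] p cur; first by exists p, [::]; rewrite cats0.
rewrite /= foldl_cat; have [q [p' ->]] := scan_lit p cur out l.
have [q' [cur' [-> E]]] := IHc q (rcons cur (p', lit_key l)).
by exists q', ((p', lit_key l) :: cur'); rewrite cat_rcons /= E.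
Qed.

Lemma scan_cnf p out phi :
  exists q out', foldl scan_step (Scan p false [::] [::] out) (syms_cnf phi) =
    Scan q false [::] [::] (out ++ out') /\
    map (map snd) out' = map (map lit_key) phi.
Proof.
elim: phi p out => [|c phi IHphi] p out; first by exists p, [::]; rewrite cats0.
rewrite /syms_cnf /= foldl_cat foldl_cat.
have [q [cur' [-> E]]] := scan_lits p [::] out c.
have [q' [out' [Eq E']]] := IHphi q.+1 (rcons out cur').
by exists q', (cur' :: out'); rewrite -cat_rcons -Eq /= E -E'.
Qed.

Lemma lit_key_inj : injective lit_key.
Proof. by case=> v s [v' s'] [-> /(can_inj nbitsK)->]. Qed.

(** The bits determine the symbols, and the scanner recovers the sign and digits of every literal
    from these; the recorded positions drop out under [map snd]. Injectivity identifies the formula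
    that [threeSAT] quantifies existentially. *)
Lemma enc_cnf_inj : injective enc_cnf.
Proof.
move=> phi psi; rewrite -!flatten_syms_cnf.
move/(flatten_shape3_inj (@size_syms_cnf phi) (@size_syms_cnf psi)) => eq_s.
have [q [out [E Eo]]] := scan_cnf 0 [::] phi.
have [q' [out' [E' Eo']]] := scan_cnf 0 [::] psi.
move: E; rewrite eq_s E' => -[_ eq_o]; rewrite -eq_o Eo' in Eo.
exact/esym/(inj_map (inj_map lit_key_inj)).
Qed.

(** Recursion on the prefix length gives every field a one-step recurrence in the position, which
    the circuits later follow gate by gate. *)
Fixpoint scan_at (sy : nat -> seq bool) (t : nat) : scan :=
  if t is t'.+1 then scan_step (scan_at sy t') (sy t') else scan0.

Section ScanAt.
Variable sy : nat -> seq bool.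
Notation st := (scan_at sy).

Lemma foldl_scan_at m : foldl scan_step scan0 (mkseq sy m) = st m.
Proof. by elim: m => // m IHm; rewrite mkseqS foldl_rcons IHm. Qed.

Lemma scan_at_pos t : s_pos (st t) = t.
Proof. by elim: t => //= t; case: (st t) => p ng dg cur out /= ->; do 4?case: ifP. Qed.

Lemma scan_at_neg t : s_neg (st t.+1) =
  (sy t == sym_neg) || is_dig (sy t) && s_neg (st t).
Proof. by rewrite /=; case: (st t) => p ng dg cur out /=; do 4?case: ifP. Qed.

Lemma scan_at_dig t : s_dig (st t.+1) =
  if is_dig (sy t) then rcons (s_dig (st t)) (sy t == sym_d true) else [::].
Proof.
rewrite /=; case: (st t) => p ng dg cur out /=; case: eqP => [->//|_].
by do 3?case: ifP.
Qed.

Lemma scan_at_cur t : s_cur (st t.+1) =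
  if sy t == sym_endcl then [::]
  else if sy t == sym_endlit
  then rcons (s_cur (st t)) (t, (~~ s_neg (st t), s_dig (st t))) else s_cur (st t).
Proof.
have := scan_at_pos t; rewrite /=; case: (st t) => p ng dg cur out /= ->.
rewrite /is_dig; have [->|_] //= := eqVneq (sy t) sym_neg.
have [->|_] //= := eqVneq (sy t) (sym_d false).
have [->|_] //= := eqVneq (sy t) (sym_d true).
by have [->|_] //= := eqVneq (sy t) sym_endlit; case: ifP.
Qed.

Lemma scan_at_out t : s_out (st t.+1) =
  if sy t == sym_endcl then rcons (s_out (st t)) (s_cur (st t)) else s_out (st t).
Proof.
rewrite /=; case: (st t) => p ng dg cur out /=.
rewrite /is_dig; have [->|_] //= := eqVneq (sy t) sym_neg.
have [->|_] //= := eqVneq (sy t) (sym_d false).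
have [->|_] //= := eqVneq (sy t) (sym_d true).
by have [->|_] //= := eqVneq (sy t) sym_endlit; case: ifP.
Qed.

(** An entry is determined by its position alone: sign and digits are those pending there. *)
Lemma scan_at_curP t x : x \in s_cur (st t) ->
  x.1 < t /\ x.2 = (~~ s_neg (st x.1), s_dig (st x.1)).
Proof.
elim: t => // t IHt; rewrite scan_at_cur; case: ifP => // _; case: ifP => [_|_ /IHt[]].
  by rewrite mem_rcons inE => /predU1P[->|/IHt[]] //; split=> //; apply: ltnW.
by split=> //; apply: ltnW.
Qed.

Lemma scan_at_cur_uniq t : uniq (map fst (s_cur (st t))).
Proof.
elim: t => // t IHt; rewrite scan_at_cur; case: ifP => // _; case: ifP => // _.
rewrite map_rcons rcons_uniq IHt andbT; apply/mapP => -[x /scan_at_curP[lt_x _] /= E].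
by rewrite E ltnn in lt_x.
Qed.

Lemma scan_at_outP t c :
  reflect (exists e, [/\ e < t, sy e = sym_endcl & c = s_cur (st e)])
          (c \in s_out (st t)).
Proof.
apply: (iffP idP) => [|[e [lt_e Ee ->]]].
  elim: t => // t IHt; rewrite scan_at_out; case: eqP => [Et|_].
    rewrite mem_rcons inE => /predU1P[->|/IHt[e [lt_e He ->]]]; first by exists t.
    by exists e; split=> //; apply: ltnW.
  by move/IHt=> [e [lt_e He ->]]; exists e; split=> //; apply: ltnW.
elim: t lt_e => // t IHt; rewrite ltnS leq_eqVlt scan_at_out => /predU1P[<-|/IHt He].
  by rewrite Ee eqxx mem_rcons mem_head.
by case: ifP => // _; rewrite mem_rcons inE He orbT.
Qed.

End ScanAt.

(** * From circuits to instruction sequences *)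

Lemma threeSAT_enc phi : is3CNF phi -> threeSAT (enc_cnf phi) <-> satisfiable phi.
Proof.
by move=> ok; split=> [[psi [_ [/enc_cnf_inj-> //]]]|sat]; exists phi.
Qed.

(* The slot of clause [c] holds [map (live k) c] when the clause is selected
   and [map (dead k) c] otherwise. The variables all lie in [2^k.+1, 2^k.+2),
   so both have encodings of the same length, and every dead clause is
   satisfied by making variable 2^k.+1 true and 2^k.+1 + k.+1 false. *)
Definition live (k : nat) (l : lit) : lit := (2 ^ k.+1 + l.1, l.2).
Definition dead (k : nat) (l : lit) : lit :=
  (2 ^ k.+1 + (if l.2 then 0 else k.+1), l.2).

Lemma size_sym_digits d : size (flatten (map sym_d d)) = 3 * size d.
Proof. by elim: d => //= b d ->; rewrite mulnS. Qed.

Lemma size_enc_lit (l : lit) : size (enc_lit l) <= 3 * size (nbits l.1) + 6.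
Proof.
rewrite /enc_lit !size_cat size_sym_digits /=.
by case: (l.2) => /=; lia.
Qed.

Lemma size_enc_map (f g : lit -> lit) c :
  {in c, forall l, size (enc_lit (f l)) = size (enc_lit (g l))} ->
  size (enc_clause (map f c)) = size (enc_clause (map g c)).
Proof.
rewrite /enc_clause !size_cat => eq_fg; congr (_ + _); rewrite !size_flatten.
congr sumn; rewrite /shape -!map_comp; exact/eq_in_map.
Qed.

Lemma size_nbits_live k l : l.1 <= k -> size (nbits (live k l).1) = k.+2.
Proof. by move=> le_l; rewrite size_nbits_pow2 //; have := @ltn_expl 2 k.+1; lia. Qed.

Lemma size_nbits_dead k l : size (nbits (dead k l).1) = k.+2.
Proof.
by rewrite size_nbits_pow2 //; have := @ltn_expl 2 k.+1; case: (l.2); lia.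
Qed.

Lemma size_enc_live_dead k l : l.1 <= k ->
  size (enc_lit (live k l)) = size (enc_lit (dead k l)).
Proof.
move=> le_l; have E : size (nbits (live k l).1) = size (nbits (dead k l).1).
  by rewrite size_nbits_live ?size_nbits_dead.
by rewrite /enc_lit !size_cat !size_sym_digits E.
Qed.

(** Each of at most three literals has k + 2 digits of three bits and at most six further bits;
    ENDCLAUSE adds three. *)
Lemma size_enc_clause_dead k c : size c <= 3 ->
  size (enc_clause (map (dead k) c)) <= 9 * k + 39.
Proof.
move=> le3; rewrite /enc_clause size_cat /=.
have : size (flatten (map enc_lit (map (dead k) c))) <= size c * (3 * k.+2 + 6).
  elim: c {le3} => //= l c IHc; rewrite size_cat mulSn leq_add //.
  by rewrite -(size_nbits_dead k l) size_enc_lit.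
by nia.
Qed.

Section Slots.
Variables (k : nat) (al : nat -> seq lit).
Hypothesis al_ok : forall i, 0 < i <= dd k -> in_Lk k (al i).

Definition slot (b : seq bool) (i : nat) : seq lit :=
  map (if nth false b i.-1 then live k else dead k) (al i).

Definition slots (b : seq bool) : seq (seq lit) := map (slot b) (iota 1 (dd k)).

(** The two codes have equal length ([size_live_dead]), so zipping them loses nothing and yields one
    function of b_i per bit of the slot. *)
Definition slot_proj (i : nat) : seq (nat * bool * bool) :=
  [seq (i, z.1, z.2) | z <- zip (enc_clause (map (live k) (al i)))
                                (enc_clause (map (dead k) (al i)))].

Definition slots_proj : seq (nat * bool * bool) :=
  flatten (map slot_proj (iota 1 (dd k))).

Lemma slot_range i : i \in iota 1 (dd k) -> 0 < i <= dd k.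
Proof. by rewrite mem_iota add1n ltnS. Qed.

Lemma size_live_dead i : 0 < i <= dd k ->
  size (enc_clause (map (live k) (al i))) = size (enc_clause (map (dead k) (al i))).
Proof.
move=> /al_ok/andP[_ /allP ok]; apply: size_enc_map => l /ok /andP[_].
exact: size_enc_live_dead.
Qed.

Lemma slots_projE b : map (proj_val b) slots_proj = enc_cnf (slots b).
Proof.
rewrite /slots_proj /enc_cnf /slots map_flatten -!map_comp; congr flatten.
apply/eq_in_map => i /slot_range /size_live_dead; rewrite /= /slot_proj /slot -map_comp.
case: ifP => b_i; move: (enc_clause _) (enc_clause (map (dead k) _)) => u v E.
  by rewrite -[RHS](@unzip1_zip _ _ u v) ?E //; apply: eq_map => z; rewrite /proj_val /= b_i.
by rewrite -[RHS](@unzip2_zip _ _ u v) ?E //; apply: eq_map => z; rewrite /proj_val /= b_i.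
Qed.

Lemma size_slots_proj : size slots_proj <= dd k * (9 * k + 39).
Proof.
have -> : size slots_proj = sumn (map (fun i => size (slot_proj i)) (iota 1 (dd k))).
  by rewrite size_flatten /shape -map_comp.
suff Hs s : {subset s <= iota 1 (dd k)} ->
    sumn (map (fun i => size (slot_proj i)) s) <= size s * (9 * k + 39).
  by rewrite -[X in _ <= X * _](size_iota 1) Hs.
elim: s => //= i s IHs Hs.
rewrite mulSn leq_add ?IHs //; last by move=> j s_j; apply: Hs; rewrite inE s_j orbT.
have /slot_range i_ok := Hs i (mem_head _ _).
rewrite size_map size2_zip ?size_live_dead // size_enc_clause_dead //.
by have /andP[/andP[_ /andP[_ ->]]] := al_ok i_ok.
Qed.

Lemma slots_is3CNF b : is3CNF (slots b).
Proof.
apply/allP => _ /mapP[i /slot_range/al_ok /andP[/andP[_ sz] _] ->].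
rewrite size_map sz; apply/allP => _ /mapP[l _ ->].
have := expn_gt0 2 k.+1; by case: ifP => _; rewrite /= addn_gt0 => ->.
Qed.

Lemma slots_satisfiable b :
  satisfiable (slots b) <->
  satisfiable [seq al i | i <- iota 1 (dd k) & nth false b i.-1].
Proof.
split=> -[a sat_a].
  exists (fun v => a (2 ^ k.+1 + v)); apply/allP => c /mapP[i].
  rewrite mem_filter => /andP[b_i i_in] ->.
  by have := allP sat_a _ (map_f _ i_in); rewrite /slot b_i has_map.
(* Offsets 1 to k follow [a]; offset 0 is true and offset k.+1 is false, as the dead literals
   require. *)
exists (fun v => let j := v - 2 ^ k.+1 in (j == 0) || (j <= k) && a j).
apply/allP => _ /mapP[i i_in ->]; have /andP[/andP[_ sz] /allP rg] := al_ok (slot_range i_in).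
rewrite /slot; case: ifP => b_i; rewrite has_map; last first.
  case: (al i) sz => // l c _ /=; apply/orP; left.
  by rewrite /lit_true /= addKn; case: (l.2) => //=; rewrite ltnn.
have /hasP[l c_l Hl] : has (lit_true a) (al i).
  by apply: (allP sat_a); rewrite map_f // mem_filter b_i.
apply/hasP; exists l => //; have /andP[l_gt0 l_le] := rg _ c_l.
by rewrite /= /lit_true /= addKn l_le (gtn_eqF l_gt0).
Qed.
End Slots.

Lemma P_lis_of_P_poly (alphas : nat -> nat -> seq lit) :
  (forall k j, 0 < j <= dd k -> in_Lk k (alphas k j)) ->
  P_poly threeSAT -> P_lis (threeSATC alphas).
Proof.
(* [len n] bounds the length of the encoding, as both k and dd k are at most n. *)
move=> al_ok [c Hc]; pose len n := n * (9 * n + 39).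
pose sz n := 4 * (len n + (c * len n ^ c + c)) + 3.
have [C HC] : exists C, forall n, sz n <= C * n ^ C + C.
  apply/poly_boundedP.
  have len_poly : poly_bounded len.
    by apply: poly_bounded_mul; [exact: poly_bounded_id | apply: poly_bounded_add;
      [apply: poly_bounded_mul; [exact: poly_bounded_const | exact: poly_bounded_id]
      | exact: poly_bounded_const]].
  by repeat (first [exact: poly_bounded_const | exact: len_poly | apply: poly_bounded_add
    | apply: poly_bounded_mul | apply: poly_bounded_exp]).
exists C => n; have [k /[dup] kn /andP[le_n lt_n]] := dd_interval n.
have le_k : k <= n by apply: leq_trans le_n; apply: leq_dd.
pose ps := slots_proj k (alphas k).
have [gs [gs_ok [gs_sz gs_P]]] := Hc (size ps).
have sz_ps : size ps <= len n.
  apply: leq_trans (size_slots_proj (al_ok k)) _.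
  by rewrite /len leq_mul // leq_add2r leq_mul2l.
have [|X [X_br X_sz X_P]] := @IS_of_circuit n gs ps _ gs_ok.
  apply/allP => p /flattenP[_ /mapP[i /slot_range i_in ->]] /mapP[z _ ->] /=.
  by case/andP: i_in => -> /leq_trans->.
exists X; split=> //; split.
  apply: leq_trans (HC n); apply: leq_trans X_sz _; rewrite leq_add2r leq_mul2l /=.
  apply: leq_add => //; apply: leq_trans gs_sz _; rewrite leq_add2r leq_mul2l.
  by apply/orP; right; case: (c) => // c'; rewrite leq_exp2r.
move=> b sz_b; have [t [r [Hrun Hout]]] := X_P b sz_b; exists t, r; split=> //.
rewrite Hout; apply: iff_trans (gs_P _ _) _; first by rewrite size_map.
rewrite slots_projE //; last exact: al_ok.
apply: iff_trans (threeSAT_enc (slots_is3CNF (al_ok k) b)) _.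
apply: iff_trans (slots_satisfiable (al_ok k) b) _.
split=> [sat|[k' [k'n sat]]]; first by exists k.
by rewrite (dd_interval_uniq kn k'n).
Qed.

(** * Building circuits *)

Definition wires (gs : seq gate) (b : seq bool) : seq bool :=
  foldl (fun w g => rcons w (gate_val w g)) b gs.

Definition gates_ok (n : nat) (gs : seq gate) : bool :=
  all (fun j => gate_ok (n + j) (nth (GConst false) gs j)) (iota 0 (size gs)).

Definition avail (n : nat) (gs : seq gate) (f : seq bool -> bool) : Prop :=
  exists2 i, i < n + size gs &
    forall b, size b = n -> nth false (wires gs b) i = f b.

(* Every circuit having the functions of [A] on its wires can be extended by
   at most [s] gates so as to have those of [B] as well. Quantifying over all
   circuits makes the costs of successive constructions add up. *)
Definition builds (n : nat) (A : (seq bool -> bool) -> Prop) (s : nat)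
    (B : (seq bool -> bool) -> Prop) : Prop :=
  forall gs, gates_ok n gs -> (forall f, A f -> avail n gs f) ->
  exists gs', [/\ gates_ok n gs', size gs' <= size gs + s,
    forall f, avail n gs f -> avail n gs' f & forall f, B f -> avail n gs' f].

(** Subformulas are built anew at each use, so costs add as in formula size; results are shared only
    through the leaf class [A]. *)
Notation formula n A s f := (builds n A s (eq f)).

Lemma gates_ok_rcons n gs g :
  gates_ok n (rcons gs g) = gates_ok n gs && gate_ok (n + size gs) g.
Proof.
rewrite /gates_ok size_rcons -addn1 iotaD all_cat /= add0n andbT nth_rcons ltnn eqxx.
congr andb; apply: eq_in_all => j; rewrite mem_iota /= => lt_j.
by rewrite nth_rcons lt_j.
Qed.

Lemma wires_rcons gs g b : wires (rcons gs g) b = rcons (wires gs b) (gate_val (wires gs b) g).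
Proof. by rewrite /wires foldl_rcons. Qed.

Lemma avail_rcons n gs g f : avail n gs f -> avail n (rcons gs g) f.
Proof.
case=> i lt_i Ef; exists i; first by rewrite size_rcons; lia.
by move=> b sz_b; rewrite wires_rcons nth_rcons size_wires sz_b lt_i Ef.
Qed.

Lemma avail_last n gs g : avail n (rcons gs g) (fun b => gate_val (wires gs b) g).
Proof.
exists (n + size gs); first by rewrite size_rcons; lia.
by move=> b sz_b; rewrite wires_rcons nth_rcons size_wires sz_b ltnn eqxx.
Qed.

Lemma avail_ext n gs f g :
  (forall b, size b = n -> f b = g b) -> avail n gs f -> avail n gs g.
Proof. by move=> fg [i lt_i Ef]; exists i => // b sz_b; rewrite Ef ?fg. Qed.

Section Builds.
Variable n : nat.
Implicit Types (A B C : (seq bool -> bool) -> Prop) (f g : seq bool -> bool).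

Lemma builds_sub A A' s s' B B' :
  (forall f, A f -> A' f) -> s <= s' -> (forall f, B' f -> B f) ->
  builds n A s B -> builds n A' s' B'.
Proof.
move=> AA' ss' BB' H gs ok_gs Hgs.
have [|gs' [ok sz mono Hb]] := H gs ok_gs; first by move=> f /AA'/Hgs.
by exists gs'; split=> // [|f /BB'/Hb//]; lia.
Qed.

(** Functions built first become leaves of the second construction. This sharing keeps a chain of
    stages additive in cost, where substituting formulas could grow exponentially. *)
Lemma builds_trans A s B t C : builds n A s B ->
  builds n (fun f => A f \/ B f) t C -> builds n A (s + t) (fun f => B f \/ C f).
Proof.
move=> H1 H2 gs ok_gs Hgs; have [gs1 [ok1 sz1 mono1 Hb1]] := H1 gs ok_gs Hgs.
have [|gs2 [ok2 sz2 mono2 Hb2]] := H2 gs1 ok1; first by move=> f [/Hgs/mono1|/Hb1].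
exists gs2; split=> //; first by lia.
  by move=> f /mono1/mono2.
by move=> f [/Hb1/mono2|/Hb2].
Qed.

Lemma builds_union A s B t C :
  builds n A s B -> builds n A t C -> builds n A (s + t) (fun f => B f \/ C f).
Proof. by move=> H1 H2; apply: builds_trans H1 _; apply: builds_sub H2 => // f; left. Qed.

Lemma builds_family (I : eqType) (l : seq I) A s (F : I -> seq bool -> bool) :
  (forall i, i \in l -> formula n A s (F i)) ->
  builds n A (size l * s) (fun f => exists2 i, i \in l & f = F i).
Proof.
elim: l => [|i l IHl] H.
  by move=> gs ok_gs _; exists gs; split=> // [|f []//]; rewrite addn0.
have /builds_union : formula n A s (F i) by apply/H/mem_head.
have {}IHl : builds n A (size l * s) (fun f => exists2 i, i \in l & f = F i).
  by apply: IHl => j l_j; apply: H; rewrite inE l_j orbT.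
move/(_ _ _ IHl); apply: builds_sub => // f [j].
by rewrite inE => /predU1P[->|l_j] ->; [left | right; exists j].
Qed.

Lemma formula_leaf A f : A f -> formula n A 0 f.
Proof. by move=> Af gs ok_gs Hgs; exists gs; split=> // [|_ <-]; [rewrite addn0 | apply: Hgs]. Qed.

Lemma formula_ext A s f g :
  (forall b, size b = n -> f b = g b) -> formula n A s f -> formula n A s g.
Proof.
move=> fg H gs ok_gs /(H gs ok_gs)[gs' [ok sz mono Hb]]; exists gs'; split=> // _ <-.
exact/(avail_ext fg)/Hb.
Qed.

Lemma formula_leq A s s' f : s <= s' -> formula n A s f -> formula n A s' f.
Proof. by move=> ss'; apply: builds_sub. Qed.

Lemma formula_const A c : formula n A 1 (fun=> c).
Proof.
move=> gs ok_gs _; exists (rcons gs (GConst c)).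
split; rewrite ?gates_ok_rcons ?ok_gs ?size_rcons ?addn1 //.
  exact: avail_rcons.
by move=> _ <-; apply: avail_last.
Qed.

Lemma formula_not A s f : formula n A s f -> formula n A s.+1 (fun b => ~~ f b).
Proof.
move=> H gs ok_gs /(H gs ok_gs)[gs' [ok sz mono Hb]].
have [i lt_i Ef] := Hb _ erefl; exists (rcons gs' (GNot i)).
split; rewrite ?gates_ok_rcons ?ok ?size_rcons //=; first by lia.
  by move=> g /mono; apply: avail_rcons.
move=> _ <-; apply: avail_ext (avail_last _ _ _) => b sz_b.
by rewrite /= Ef.
Qed.

Lemma formula_and A s t f g : formula n A s f -> formula n A t g ->
  formula n A (s + t).+1 (fun b => f b && g b).
Proof.
move=> Hf Hg gs ok_gs /(builds_union Hf Hg ok_gs)[gs' [ok sz mono Hb]].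
have [[i lt_i Ef] [j lt_j Eg]] := (Hb f (or_introl erefl), Hb g (or_intror erefl)).
exists (rcons gs' (GAnd i j)); split; rewrite ?gates_ok_rcons ?ok ?size_rcons //=.
- by rewrite lt_i.
- by lia.
- by move=> h /mono; apply: avail_rcons.
move=> _ <-; apply: avail_ext (avail_last _ _ _) => b sz_b.
by rewrite /= Ef ?Eg.
Qed.

(** By De Morgan: three negations and one conjunction. *)
Lemma formula_or A s t f g : formula n A s f -> formula n A t g ->
  formula n A (s + t).+4 (fun b => f b || g b).
Proof.
move=> /formula_not Hf /formula_not Hg; have := formula_not (formula_and Hf Hg).
move/(formula_leq (s' := (s + t).+4)) => H; have {}H := H ltac:(lia).
by apply: formula_ext H => b _; rewrite negb_and !negbK.
Qed.

(** The condition is built twice but each branch only once, which keeps recursions through a branch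
    linear. *)
Lemma formula_if A s t u c f g :
  formula n A s c -> formula n A t f -> formula n A u g ->
  formula n A (2 * s + t + u + 7) (fun b => if c b then f b else g b).
Proof.
move=> Hc Hf Hg; have := formula_or (formula_and Hc Hf) (formula_and (formula_not Hc) Hg).
move=> /(formula_leq (s' := 2 * s + t + u + 7)) H; have {}H := H ltac:(lia).
by apply: formula_ext H => b _; case: (c b); rewrite ?orbF.
Qed.

Lemma formula_eq A s t f g : formula n A s f -> formula n A t g ->
  formula n A (2 * (s + t) + 8) (fun b => f b == g b).
Proof.
move=> Hf Hg; have := formula_if Hf Hg (formula_not Hg).
move=> /(formula_leq (s' := 2 * (s + t) + 8)) H; have {}H := H ltac:(lia).
by apply: formula_ext H => b _; case: (f b); case: (g b).
Qed.

Lemma formula_all (I : eqType) (l : seq I) A s (F : I -> seq bool -> bool) :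
  (forall i, i \in l -> formula n A s (F i)) ->
  formula n A (size l * s.+1).+1 (fun b => all (F^~ b) l).
Proof.
elim: l => [|i l IHl] H; first by apply: formula_const.
have Hi : formula n A s (F i) by apply/H/mem_head.
have {}IHl : formula n A (size l * s.+1).+1 (fun b => all (F^~ b) l).
  by apply: IHl => j l_j; apply: H; rewrite inE l_j orbT.
by apply: formula_leq (formula_and Hi IHl); rewrite /= mulSn; lia.
Qed.

Lemma formula_has (I : eqType) (l : seq I) A s (F : I -> seq bool -> bool) :
  (forall i, i \in l -> formula n A s (F i)) ->
  formula n A (size l * s.+4).+1 (fun b => has (F^~ b) l).
Proof.
elim: l => [|i l IHl] H; first by apply: formula_const.
have Hi : formula n A s (F i) by apply/H/mem_head.
have {}IHl : formula n A (size l * s.+4).+1 (fun b => has (F^~ b) l).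
  by apply: IHl => j l_j; apply: H; rewrite inE l_j orbT.
by apply: formula_leq (formula_or Hi IHl); rewrite /= mulSn; lia.
Qed.

Definition input_bit (f : seq bool -> bool) : Prop :=
  exists2 i, i < n & f = fun b => nth false b i.

Lemma circuit_of_builds s f : builds n input_bit s (eq f) ->
  exists gs, [/\ circuit_ok n gs, size gs <= s.+1 &
    forall b, size b = n -> circ_eval gs b = f b].
Proof.
case/(_ [::] isT) => [_ [i lt_i ->]|gs [ok sz _ /(_ _ erefl)[i lt_i Ef]]].
  by exists i; rewrite ?addn0.
(* The output must be the last gate, while wire [i] may be anywhere, even an input; the extra gate
   copies it. *)
exists (rcons gs (GOr i i)); split; first 1 last.
- by rewrite size_rcons.
- move=> b sz_b; rewrite /circ_eval -/(wires _ _) wires_rcons last_rcons /=.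
  by rewrite Ef // orbb.
rewrite /circuit_ok -/(gates_ok _ _) size_rcons gates_ok_rcons ok /=.
by rewrite lt_i.
Qed.

End Builds.

(** * Circuits from instruction sequences *)

(* Jumps only go forward, so one sweep over the positions simulates a run:
   position [t] acts when the counter equals [t] and is skipped otherwise.
   Counter 0 stands for an execution that has stopped. *)
Record sweep_state := Sweep { w_pc : nat; w_aux : nat -> bool; w_out : bool }.

Definition reply (x : nat -> bool) (s : sweep_state) (a : basic) : bool :=
  match a with
  | (_, MSet v) => v
  | (FIn i, MGet) => x i
  | (FAux i, MGet) => w_aux s i
  | (FOut, MGet) => w_out s
  end.

Definition basic_of (u : prim) : option basic :=
  match u with PPlain a | PPos a | PNeg a => Some a | _ => None end.

Definition prim_reply (x : nat -> bool) (s : sweep_state) (u : prim) : bool :=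
  if basic_of u is Some a then reply x s a else false.

Definition next_pc (t : nat) (u : prim) (rep : bool) : nat :=
  match u with
  | PTerm => 0
  | PJump l => if l == 0 then 0 else t + l
  | PPlain _ => t.+1
  | PPos _ => if rep then t.+1 else t.+2
  | PNeg _ => if rep then t.+2 else t.+1
  end.

Definition next_aux (u : prim) (aux : nat -> bool) (i : nat) : bool :=
  if basic_of u is Some (FAux j, MSet v) then if i == j then v else aux i else aux i.

Definition next_out (u : prim) (out : bool) : bool :=
  if basic_of u is Some (FOut, MSet v) then v else out.

Definition sweep_step x (t : nat) (u : prim) (s : sweep_state) : sweep_state :=
  if w_pc s == t then
    Sweep (next_pc t u (prim_reply x s u)) (next_aux u (w_aux s)) (next_out u (w_out s))
  else s.

Fixpoint sweep (x : nat -> bool) (X : seq prim) (t : nat) : sweep_state :=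
  if t is t'.+1 then sweep_step x t (nth PTerm X t') (sweep x X t')
  else Sweep 1 (fun=> false) false.

Lemma sweep_stopped x X t d : w_pc (sweep x X t) = 0 ->
  w_out (sweep x X (t + d)) = w_out (sweep x X t).
Proof.
move=> Hpc; suff -> : sweep x X (t + d) = sweep x X t by [].
elim: d => [|d IHd]; first by rewrite addn0.
by rewrite addnS /= /sweep_step IHd Hpc.
Qed.

Lemma run_stopped n X T o : (forall pc r, o <> Run pc r) -> run n X T o = o.
Proof. by case: T => //= T; case: o => // pc r /(_ pc r). Qed.

(** Invariant: after [t] positions the registers agree with those of the run and the counter lies
    beyond [t], which forward moves preserve. Deadlock and forbidden access make [run] end in
    [Fail], contradicting the assumption that it halts. *)
Lemma sweep_run n x X T t r r' : all prim_br X -> t <= size X ->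
  r_in r = x -> r_aux r = w_aux (sweep x X t) -> r_out r = w_out (sweep x X t) ->
  t < w_pc (sweep x X t) -> run n X T (Run (w_pc (sweep x X t)) r) = Halt r' ->
  w_out (sweep x X (size X)) = r_out r'.
Proof.
move=> br_X le_t; move: {2}(size X - t) (erefl (size X - t)) => d.
elim: d t T r le_t => [|d IHd] t T r le_t Ed Ei Ea Eo lt_pc Hrun.
  case: T Hrun => //= T; rewrite /step.
  have -> : (w_pc (sweep x X t) == 0) || (size X < w_pc (sweep x X t)) by lia.
  by rewrite run_stopped.
have lt_t : t < size X by lia.
have := IHd t.+1; rewrite /= /sweep_step; case: eqP => [Epc|Npc] IH; last first.
  by apply: (IH T r); rewrite //; lia.
have br_u : prim_br (nth PTerm X t) by apply: (all_nthP PTerm br_X).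
move: Hrun; rewrite Epc; case: T => //= T; rewrite /step /= ltnNge lt_t /=.
case E : (nth PTerm X t) br_u IH => [a|a|a|l|] br_u IH /=; last first.
- rewrite run_stopped // => -[<-].
  have -> : size X = t.+1 + (size X - t.+1) by lia.
  by rewrite sweep_stopped /= /sweep_step Epc eqxx E /=.
- move: IH; rewrite /next_pc; case: ifP => [_ _|l0 IH Hrun]; first by rewrite run_stopped.
  by apply: (IH T r) => //=; lia.
all: case: a E br_u IH => [[i|i|] [v|]] E //= br_u; rewrite /next_pc /next_aux /next_out /prim_reply /= => IH.
all: try (case: ifP => // _; last by rewrite run_stopped).
all: rewrite ?Ei ?Ea.
all: move=> Hrun; apply: IH Hrun => //=.
all: try (case: ifP => _); lia.
Qed.

Lemma sweep_computes n X b T r : all prim_br X ->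
  run n X T (Run 1 (init_regs b)) = Halt r ->
  w_out (sweep (fun j => nth false b j.-1) X (size X)) = r_out r.
Proof. by move=> br_X Hrun; apply: (sweep_run (t := 0) br_X _ _ _ _ _ Hrun). Qed.

(** Only auxiliary registers that some instruction reads get a wire, so there are at most [size X]
    of them, however large their indices. *)
Definition read_aux (u : prim) : option nat :=
  if basic_of u is Some (FAux i, MGet) then Some i else None.

Section SweepCircuit.
Variables (n s : nat) (A : (seq bool -> bool) -> Prop) (x : nat -> seq bool -> bool).
Variable X : seq prim.
Hypothesis x_formula : forall i, formula n A s (x i).
Let auxs := pmap read_aux X.
Let st t w := sweep (x^~ w) X t.

(** The counter is held in one-hot form. Values 0 and beyond [size X] need no wire, because no
    position acts on them. *)
Definition sweep_wires (t : nat) (f : seq bool -> bool) : Prop :=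
  ((exists2 j, j \in iota 1 (size X) & f = fun w => w_pc (st t w) == j) \/
   (exists2 i, i \in auxs & f = fun w => w_aux (st t w) i)) \/
  f = fun w => w_out (st t w).

(** At most [size X] counter wires, [size X] registers and one output. The dearest is a counter
    wire, which tests a reply of cost s + 1 inside two nested conditionals. *)
Definition stage_cost : nat := (2 * size X).+1 * (2 * s + 20).

Lemma builds_sweep_wires B t K :
  (forall j, j \in iota 1 (size X) -> formula n B K (fun w => w_pc (st t w) == j)) ->
  (forall i, i \in auxs -> formula n B K (fun w => w_aux (st t w) i)) ->
  formula n B K (fun w => w_out (st t w)) ->
  builds n B ((2 * size X).+1 * K) (sweep_wires t).
Proof.
move=> Hpc Haux Hout.
have H := builds_union (builds_union (builds_family Hpc) (builds_family Haux)) Hout.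
apply: builds_sub H => // [|f [[Hf|Hf]|->]]; [|by left; left|by left; right|by right].
have le_aux : size auxs <= size X by rewrite size_pmap count_size.
by rewrite size_iota -mulnDl -mulSnr leq_mul2r ltnS mul2n -addnn leq_add2l le_aux orbT.
Qed.

Lemma mem_read_aux t i : read_aux (nth PTerm X t) = Some i -> i \in auxs.
Proof.
rewrite /auxs; elim: X t => [|u Y IHY] [|t] //= => [->|/IHY]; first exact: mem_head.
by case: (read_aux u) => //= j; rewrite inE orbC => ->.
Qed.

Lemma prim_reply_formula t :
  formula n (fun f => A f \/ sweep_wires t f) s.+1
    (fun w => prim_reply (x^~ w) (st t w) (nth PTerm X t)).
Proof.
set B := fun f => _.
have HA f k : formula n A k f -> formula n B k f by apply: builds_sub => // g; left.
have leaf f : sweep_wires t f -> formula n B s.+1 f.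
  by move=> Hf; apply: (formula_leq (s := 0)) => //; apply: formula_leaf; right.
have cst c : formula n B s.+1 (fun=> c) by apply: formula_leq (@formula_const n B c).
rewrite /prim_reply; have := @mem_read_aux t; rewrite /read_aux.
case: (basic_of _) => [[f [v|]]|] //=; case: f => [i|i|] //= Hi.
- by apply: formula_leq (HA _ _ (x_formula i)).
- by apply: leaf; left; right; exists i => //; apply: Hi.
- by apply: leaf; right.
Qed.

Lemma sweep_stage t : t < size X ->
  builds n (fun f => A f \/ sweep_wires t f) stage_cost (sweep_wires t.+1).
Proof.
move=> lt_t; set B := fun f => _.
have leaf f : sweep_wires t f -> formula n B 0 f by move=> Hf; apply: formula_leaf; right.
have here : formula n B 0 (fun w => w_pc (st t w) == t.+1).
  by apply: leaf; left; left; exists t.+1 => //; rewrite mem_iota; lia.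
apply: builds_sweep_wires => [j j_in|i i_in|].
- have old : formula n B 0 (fun w => w_pc (st t w) == j) by apply: leaf; left; left; exists j.
  (* The instruction at this position is fixed, so for each reply it is a constant whether the next
     counter equals [j]. *)
  have new := formula_if (@prim_reply_formula t)
    (@formula_const n B (next_pc t.+1 (nth PTerm X t) true == j))
    (@formula_const n B (next_pc t.+1 (nth PTerm X t) false == j)).
  have := formula_if here new old.
  move/(formula_leq (s' := 2 * s + 20)) => H; have {}H := H ltac:(lia).
  apply: formula_ext H => w _; rewrite /st /= /sweep_step; case: ifP => //= _.
  by case: (prim_reply _ _ _).
- have old : formula n B 0 (fun w => w_aux (st t w) i) by apply: leaf; left; right; exists i.
  have new : formula n B 1 (fun w => next_aux (nth PTerm X t) (w_aux (st t w)) i).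
    rewrite /next_aux; case: (basic_of _) => [[[j|j|] [v|]]|]; try exact: formula_leq old.
    by case: eqP => _; [exact: formula_const | exact: formula_leq old].
  have := formula_if here new old.
  move/(formula_leq (s' := 2 * s + 20)) => H; have {}H := H ltac:(lia).
  by apply: formula_ext H => w _; rewrite /st /= /sweep_step; case: ifP.
- have old : formula n B 0 (fun w => w_out (st t w)) by apply: leaf; right.
  have new : formula n B 1 (fun w => next_out (nth PTerm X t) (w_out (st t w))).
    rewrite /next_out; case: (basic_of _) => [[[j|j|] [v|]]|]; try exact: formula_leq old.
    exact: formula_const.
  have := formula_if here new old.
  move/(formula_leq (s' := 2 * s + 20)) => H; have {}H := H ltac:(lia).
  by apply: formula_ext H => w _; rewrite /st /= /sweep_step; case: ifP.
Qed.

Lemma builds_sweep t : t <= size X -> builds n A (t.+1 * stage_cost) (sweep_wires t).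
Proof.
elim: t => [|t IHt] le_t.
  have cst c : formula n A (2 * s + 20) (fun=> c).
    by apply: formula_leq (@formula_const n A c); rewrite addn_gt0 orbT.
  by rewrite mul1n; apply: builds_sweep_wires => *; apply: cst.
have := builds_trans (IHt (ltnW le_t)) (sweep_stage le_t).
by apply: builds_sub => // [|f]; [rewrite [t.+2 * _]mulSn addnC | right].
Qed.

Lemma sweep_formula :
  formula n A ((size X).+1 * stage_cost) (fun w => w_out (sweep (x^~ w) X (size X))).
Proof. by apply: builds_sub (builds_sweep (leqnn _)) => // _ <-; right. Qed.
End SweepCircuit.

(** * Extracting the selected clauses *)

(* The encodings of formulas whose clauses are nonempty and whose variables
   are positive form a 2-local language. *)
Definition sym_ok (x y : seq bool) : bool :=
  [|| y == sym_d true,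
      (y == sym_neg) && ((x == sym_endlit) || (x == sym_endcl)),
      ((y == sym_d false) || (y == sym_endlit)) && is_dig x |
      (y == sym_endcl) && (x == sym_endlit)].

Definition well_formed (phi : seq (seq lit)) : bool :=
  all (fun c => (0 < size c) && all (fun l => 0 < l.1) c) phi.

Lemma sym_ok_digits d x : is_dig x ->
  path sym_ok x (map sym_d d ++ [:: sym_endlit]).
Proof.
elim: d x => [|b d IHd] x x_dig; first by rewrite /= /sym_ok x_dig.
by rewrite /= IHd; case: b; rewrite // /sym_ok x_dig.
Qed.

Lemma sym_ok_lit l x : 0 < l.1 -> (x == sym_endlit) || (x == sym_endcl) ->
  path sym_ok x (syms_lit l).
Proof.
case: l => v s /= /nbits_pos[d Ed] x_ok; rewrite /syms_lit /= Ed.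
by case: s; rewrite /= sym_ok_digits // andbT // /sym_ok x_ok.
Qed.

Lemma last_syms_lit l x : last x (syms_lit l) = sym_endlit.
Proof. by rewrite /syms_lit !last_cat. Qed.

Lemma sym_ok_lits c x : all (fun l => 0 < l.1) c -> (x == sym_endlit) || (x == sym_endcl) ->
  path sym_ok x (flatten (map syms_lit c)).
Proof.
elim: c x => //= l c IHc x /andP[l_ok c_ok] x_ok.
by rewrite cat_path sym_ok_lit ?IHc // last_syms_lit.
Qed.

Lemma sym_ok_cnf phi : well_formed phi ->
  path sym_ok sym_endcl (syms_cnf phi) && (last sym_endcl (syms_cnf phi) == sym_endcl).
Proof.
elim: phi => //= c phi IHphi /andP[/andP[c_gt0 c_ok] /IHphi/andP[p_ok l_ok]].
rewrite /syms_cnf /= cat_path last_cat /syms_clause last_cat cat_path sym_ok_lits //=.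
rewrite p_ok l_ok !andbT; case/lastP: c c_gt0 {c_ok} => // c l _.
by rewrite map_rcons flatten_rcons last_cat last_syms_lit.
Qed.

(** Induction over suffixes requires a claim for every preceding symbol: after ENDCLAUSE a formula
    follows, after ENDLIT the rest of a clause, after NEG a numeral with leading 1, after a digit
    the rest of a numeral. Only the digit 1 can start a numeral, since [sym_ok] wants a digit before
    0 and before ENDLIT. *)
Lemma sym_ok_decode ss x : path sym_ok x ss -> last x ss = sym_endcl ->
  [/\ x = sym_endcl -> exists2 phi, well_formed phi & ss = syms_cnf phi,
      x = sym_endlit -> exists c phi,
        [/\ all (fun l => 0 < l.1) c, well_formed phi &
            ss = syms_clause c ++ syms_cnf phi],
      x = sym_neg -> exists d c phi,
        [/\ all (fun l => 0 < l.1) c, well_formed phi &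
            ss = map sym_d (true :: d) ++ sym_endlit :: syms_clause c ++ syms_cnf phi] &
      is_dig x -> exists d c phi,
        [/\ all (fun l => 0 < l.1) c, well_formed phi &
            ss = map sym_d d ++ sym_endlit :: syms_clause c ++ syms_cnf phi]].
Proof.
elim: ss x => [|y ss IHss] x /=; first by move=> _ ->; split=> // _; exists [::].
case/andP=> xy /IHss IH /IH[Hcl Hlit Hneg Hdig].
have lit_d d c phi : all (fun l : lit => 0 < l.1) c ->
    let c' := (bits_val (true :: d), true) :: c in
    all (fun l : lit => 0 < l.1) c' /\
    map sym_d (true :: d) ++ sym_endlit :: syms_clause c ++ syms_cnf phi
      = syms_clause c' ++ syms_cnf phi.
  move=> c_ok; rewrite /syms_clause /= /syms_lit /= c_ok bits_valK bits_val_gt0 andbT.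
  by rewrite -!catA.
have lit_n d c phi : all (fun l : lit => 0 < l.1) c ->
    let c' := (bits_val (true :: d), false) :: c in
    all (fun l : lit => 0 < l.1) c' /\
    sym_neg :: map sym_d (true :: d) ++ sym_endlit :: syms_clause c ++ syms_cnf phi
      = syms_clause c' ++ syms_cnf phi.
  move=> c_ok; rewrite /syms_clause /= /syms_lit /= c_ok bits_valK bits_val_gt0 andbT.
  by rewrite -!catA.
have cons_ok c l phi : all (fun l : lit => 0 < l.1) (l :: c) -> well_formed phi ->
  exists2 psi, well_formed psi & syms_clause (l :: c) ++ syms_cnf phi = syms_cnf psi.
  by move=> c_ok phi_ok; exists ((l :: c) :: phi) => //; apply/andP.
case/or4P: xy => [/eqP Ey|/andP[/eqP Ey Ex]|/andP[Ey Ex]|/andP[/eqP Ey /eqP Ex]].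
- have [|d [c [phi [c_ok phi_ok ->]]]] := Hdig; first by rewrite Ey.
  have [/= c'_ok Es] := lit_d d c phi c_ok.
  split=> _.
  + have [psi psi_ok Epsi] := cons_ok c (bits_val (true :: d), true) phi c'_ok phi_ok.
    by exists psi; rewrite // -Epsi -Es Ey.
  + by exists ((bits_val (true :: d), true) :: c), phi; rewrite -Es Ey.
  + by exists d, c, phi; rewrite Ey.
  + by exists (true :: d), c, phi; rewrite Ey.
- have [//|d [c [phi [c_ok phi_ok ->]]]] := Hneg.
  have [c'_ok Es] := lit_n d c phi c_ok.
  split=> E; try by [rewrite E in Ex | case/orP: Ex => /eqP Ex; rewrite Ex in E].
  + have [psi psi_ok Epsi] := cons_ok c (bits_val (true :: d), false) phi c'_ok phi_ok.
    by exists psi; rewrite // -Epsi -Es Ey.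
  + by exists ((bits_val (true :: d), false) :: c), phi; rewrite -Es Ey.
- split=> E; try by rewrite E in Ex.
  case/orP: Ey => /eqP Ey.
    have [|d [c [phi [c_ok phi_ok ->]]]] := Hdig; first by rewrite Ey.
    by exists (false :: d), c, phi; rewrite Ey.
  have [//|c [phi [c_ok phi_ok ->]]] := Hlit.
  by exists [::], c, phi; rewrite Ey.
- split=> E; try by rewrite Ex in E.
  have [//|phi phi_ok ->] := Hcl.
  by exists [::], phi; rewrite Ey.
Qed.

Section Extract.
Variables (sy : nat -> seq bool) (m : nat) (al : nat -> seq lit).
Hypothesis al_bij : alpha_bij m al.
Notation st := (scan_at sy).

Definition lits_upto : seq lit := [seq (v, s) | v <- iota 1 m, s <- [:: true; false]].

Definition cur_lits (t : nat) : seq lit := [seq (x.1.+1, x.2.1) | x <- s_cur (st t)].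

(** Equality of sets of literals over v_1, ..., v_m, written as a finite conjunction for the
    circuits. *)
Definition same_lits (c c' : seq lit) : bool :=
  all (fun l => (l \in c) == (l \in c')) lits_upto.

(* Each ENDLIT position [p] yields its own variable [p.+1]. Implications
   between the variables of positions preceded by the same digits make all
   occurrences of one variable of the encoded formula take the same value. *)
Definition link (pq : nat * nat) : seq lit := [:: (pq.1.+1, false); (pq.2.+1, true)].

Definition positions2 : seq (nat * nat) := [seq (p, q) | p <- iota 0 m, q <- iota 0 m].

(** Links join all pairs of positions, not only ENDLIT ones. The surplus is harmless: the value
    intended for v_{p+1} depends only on the digits pending at p, so every such link holds. *)
Definition selected (i : nat) : bool :=
  has (fun e => (sy e == sym_endcl) && same_lits (cur_lits e) (al i)) (iota 0 m)
  || has (fun pq => same_lits (link pq) (al i) && (s_dig (st pq.1) == s_dig (st pq.2)))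
         positions2.

Definition clauses_short : bool :=
  all (fun e => (sy e != sym_endcl) ||
         has (fun i => same_lits (cur_lits e) (al i)) (iota 1 (dd m))) (iota 0 m).

Lemma mem_lits_upto l : (l \in lits_upto) = (0 < l.1 <= m).
Proof.
case: l => v s; apply/allpairsP/idP => [[[v' s'] /= [v'_in _ [-> _]]]|v_in].
  by rewrite mem_iota in v'_in; lia.
by exists (v, s); split; [rewrite mem_iota | case: (s) | ].
Qed.

Lemma same_litsP c c' : all (fun l => 0 < l.1 <= m) c -> all (fun l => 0 < l.1 <= m) c' ->
  reflect (c =i c') (same_lits c c').
Proof.
move=> /allP c_ok /allP c'_ok; apply: (iffP allP) => [H l|H l _]; last by rewrite H eqxx.
have [/H/eqP//|] := boolP (l \in lits_upto).
rewrite mem_lits_upto => /negP l_out.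
by apply/idP/idP => [/c_ok/l_out|/c'_ok/l_out].
Qed.

Lemma in_Lk_range k c : in_Lk k c -> all (fun l => 0 < l.1 <= k) c.
Proof. by case/andP. Qed.

Lemma cur_lits_range e : e < m -> all (fun l => 0 < l.1 <= m) (cur_lits e).
Proof.
move=> lt_e; apply/allP => _ /mapP[x /scan_at_curP[lt_x _] ->] /=.
by rewrite (ltn_trans lt_x).
Qed.

Lemma cur_lits_uniq e : uniq (cur_lits e).
Proof.
apply: (@map_uniq _ _ (fun l : lit => l.1)).
rewrite -map_comp; have -> : map ((fun l : lit => l.1) \o (fun x => (x.1.+1, x.2.1))) (s_cur (st e))
  = map S (map fst (s_cur (st e))) by rewrite -map_comp.
by rewrite map_inj_uniq ?scan_at_cur_uniq // => ? ? [].
Qed.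

Lemma al_range i : i \in iota 1 (dd m) -> in_Lk m (al i).
Proof. by case: al_bij => H _; rewrite mem_iota add1n ltnS; apply: H. Qed.

Lemma al_surj c : in_Lk m c -> exists2 i, i \in iota 1 (dd m) & al i =i c.
Proof.
case: al_bij => _ [_ H] /H[i [i_in Ei]]; exists i => //.
by rewrite mem_iota add1n ltnS.
Qed.

Variable phi : seq (seq lit).
Hypothesis phi_syms : mkseq sy m = syms_cnf phi.
Hypothesis phi_wf : well_formed phi.

Lemma scan_out_phi : map (map snd) (s_out (st m)) = map (map lit_key) phi.
Proof.
have [q [out [E Eo]]] := scan_cnf 0 [::] phi.
by rewrite -Eo -foldl_scan_at phi_syms /scan0 E.
Qed.

Lemma clause_of_end e : e < m -> sy e = sym_endcl ->
  exists2 c, c \in phi & map snd (s_cur (st e)) = map lit_key c.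
Proof.
move=> lt_e Ee; apply/mapP; rewrite -scan_out_phi map_f //.
by apply/scan_at_outP; exists e.
Qed.

Lemma end_of_clause c : c \in phi ->
  exists e, [/\ e < m, sy e = sym_endcl & map snd (s_cur (st e)) = map lit_key c].
Proof.
move=> /(map_f (map lit_key)); rewrite -scan_out_phi => /mapP[_ /scan_at_outP[e [lt_e Ee ->]] ->].
by exists e.
Qed.

Lemma size_cur_lits e c : map snd (s_cur (st e)) = map lit_key c -> size (cur_lits e) = size c.
Proof. by move/(congr1 size); rewrite !size_map. Qed.

Lemma cur_lits_in_Lk e : e < m -> in_Lk m (cur_lits e) = (0 < size (cur_lits e) <= 3).
Proof. by move=> lt_e; rewrite /in_Lk cur_lits_uniq cur_lits_range // andbT. Qed.

(** The renamed literals of a clause are distinct, so their set occurs among the values of [al]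
    exactly when the clause has one to three literals. *)
Lemma clauses_shortP : clauses_short = all (fun c => size c <= 3) phi.
Proof.
apply/allP/allP => [H c /end_of_clause[e [lt_e Ee Ec]]|H e].
  have := H e; rewrite mem_iota lt_e Ee eqxx => /(_ isT) /hasP[i i_in].
  have al_ok := al_range i_in.
  move/(same_litsP (cur_lits_range lt_e) (in_Lk_range al_ok)) => Ei.
  case/andP: al_ok => /andP[U sz] _; rewrite -(size_cur_lits Ec).
  by rewrite (perm_size (uniq_perm (cur_lits_uniq e) U Ei)); case/andP: sz.
rewrite mem_iota => /= lt_e; case: eqP => //= Ee.
have [c c_phi Ec] := clause_of_end lt_e Ee.
have [|i i_in Ei] := @al_surj (cur_lits e).
  by rewrite cur_lits_in_Lk // (size_cur_lits Ec) H // andbT; case/andP: (allP phi_wf c c_phi).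
apply/hasP; exists i => //; apply/same_litsP => //; first exact: cur_lits_range.
exact/in_Lk_range/al_range.
Qed.

(** The opposite signs keep the two literals distinct even if p = q. *)
Lemma link_in_Lk p q : p < m -> q < m -> in_Lk m (link (p, q)).
Proof. by move=> lt_p lt_q; rewrite /in_Lk /= lt_p lt_q inE xpair_eqE andbF. Qed.

Lemma selected_cur e i : e < m -> sy e = sym_endcl -> i \in iota 1 (dd m) ->
  al i =i cur_lits e -> selected i.
Proof.
move=> lt_e Ee i_in Ei; apply/orP; left; apply/hasP; exists e; first by rewrite mem_iota.
rewrite Ee eqxx; apply/same_litsP => //; first exact: cur_lits_range.
exact/in_Lk_range/al_range.
Qed.

Lemma selected_link p q i : p < m -> q < m -> s_dig (st p) = s_dig (st q) ->
  i \in iota 1 (dd m) -> al i =i link (p, q) -> selected i.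
Proof.
move=> lt_p lt_q E i_in Ei; apply/orP; right; apply/hasP; exists (p, q).
  by apply/allpairsP; exists (p, q); rewrite !mem_iota.
rewrite /= E eqxx andbT; apply/same_litsP => //; apply/in_Lk_range; first exact: link_in_Lk.
exact: al_range.
Qed.

Lemma has_eq_mem (T : eqType) (a : pred T) (c c' : seq T) : c =i c' -> has a c = has a c'.
Proof. by move/eq_has_r. Qed.

Lemma selected_satisfiable : all (fun c => size c <= 3) phi ->
  satisfiable phi <-> satisfiable [seq al i | i <- iota 1 (dd m) & selected i].
Proof.
move=> short; split=> -[a sat_a].
  (* The new variable v_{p+1} takes the value of the original variable whose digits are pending at
     position p. *)
  exists (fun v => a (bits_val (s_dig (st v.-1)))); apply/allP => c' /mapP[i].
  rewrite mem_filter => /andP[sel i_in] ->; case/orP: sel => /hasP[].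
    move=> e; rewrite mem_iota => /= lt_e /andP[/eqP Ee].
    move/(same_litsP (cur_lits_range lt_e) (in_Lk_range (al_range i_in))) => Ei.
    have [c c_phi Ec] := clause_of_end lt_e Ee.
    have /hasP[l c_l l_true] := allP sat_a c c_phi.
    have : lit_key l \in map snd (s_cur (st e)) by rewrite Ec map_f.
    case/mapP=> y y_cur Ey; apply/hasP; exists (y.1.+1, y.2.1); first by rewrite -Ei map_f.
    have [_ Ey'] := scan_at_curP y_cur.
    rewrite /lit_true /=; have -> : s_dig (st y.1) = nbits l.1.
      by have := congr1 snd Ey; rewrite Ey' /= => <-.
    by rewrite nbitsK -Ey.
  move=> _ /allpairsP[[p q] [/= + + ->]]; rewrite !mem_iota /= => lt_p lt_q.
  case/andP=> /(same_litsP (in_Lk_range (link_in_Lk lt_p lt_q)) (in_Lk_range (al_range i_in))) Ei /eqP E.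
  by rewrite -(has_eq_mem _ Ei) /= /lit_true /= E; case: (a _).
pose occs := flatten (s_out (st m)).
(* An original variable is true if some occurrence of it is; the links will show that all its
   occurrences agree. *)
exists (fun v => has (fun y => (y.2.2 == nbits v) && a y.1.+1) occs).
apply/allP => c c_phi; have [e [lt_e Ee Ec]] := end_of_clause c_phi.
have sat i : i \in iota 1 (dd m) -> selected i -> has (lit_true a) (al i).
  by move=> i_in sel; apply: (allP sat_a); rewrite map_f // mem_filter sel.
have in_occs y : y \in s_cur (st e) -> y \in occs.
  move=> y_cur; apply/flattenP; exists (s_cur (st e)) => //.
  by apply/scan_at_outP; exists e.
have [|i i_in Ei] := @al_surj (cur_lits e).
  rewrite cur_lits_in_Lk // (size_cur_lits Ec) (allP short) // andbT.
  by case/andP: (allP phi_wf c c_phi).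
have := sat i i_in (selected_cur lt_e Ee i_in Ei).
rewrite (has_eq_mem _ Ei) => /hasP[_ /mapP[y y_cur ->]]; rewrite /lit_true /= => y_true.
have : y.2 \in map lit_key c by rewrite -Ec map_f.
case/mapP=> l c_l Ey; apply/hasP; exists l => //=.
have El : y.2.1 = l.2 by rewrite Ey.
rewrite /lit_true /= -El -(eqP y_true); apply/eqP.
apply/idP/idP => [/hasP[y' y'_occ /andP[/eqP Ey' y'_true]]|ay]; last first.
  by apply/hasP; exists y; rewrite ?in_occs // ay andbT Ey.
have /flattenP[_ /scan_at_outP[e' [lt_e' _ ->]] y'_cur] := y'_occ.
have [lt_y E1] := scan_at_curP y_cur; have [lt_y' E2] := scan_at_curP y'_cur.
have lt_ym := ltn_trans lt_y lt_e; have lt_y'm := ltn_trans lt_y' lt_e'.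
have Ed : s_dig (st y'.1) = s_dig (st y.1).
  by have := Ey'; rewrite -[nbits _]/((lit_key l).2) -Ey E1 E2.
(* The link from the true occurrence [y'] to [y] is a selected clause and forces [y] to be true. *)
have [i' i'_in Ei'] := al_surj (link_in_Lk lt_y'm lt_ym).
have := sat i' i'_in (selected_link lt_y'm lt_ym Ed i'_in Ei').
by rewrite (has_eq_mem _ Ei') /= /lit_true /= y'_true orbF => /eqP.
Qed.

End Extract.

(** * From instruction sequences to circuits *)

(** Gate counts with room to spare, so that the recurrences below close by linear arithmetic. *)
Definition mem_cost m := m * (300 * m.+1) + 1.
Definition same_cost m := 2 * m * (2 * mem_cost m + 11) + 1.
Definition selected_cost m :=
  m * (same_cost m + 40) + m * m * (m * 500 + 100) + 10.
Definition short_cost m := m * (dd m * (same_cost m + 4) + 50) + 1.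
Definition valid_cost m := m * 500 + 100.

Section ParserCircuit.
Variables (m : nat) (al : nat -> seq lit).
Notation n := (3 * m).
Notation bits := (input_bit n).
Notation st w := (scan_at (sym_at w)).

Lemma bit_formula i : i < n -> formula n bits 0 (fun w => nth false w i).
Proof. by move=> lt_i; apply: formula_leaf; exists i. Qed.

(** Circuits see a symbol only through comparisons with constants. Three bit tests of ten gates and
    two conjunctions make 32. *)
Definition readable (x : seq bool -> seq bool) : Prop :=
  forall s, size s = 3 -> formula n bits 32 (fun w => x w == s).

Lemma readable_sym p : p < m -> readable (sym_at^~ p).
Proof.
move=> lt_p s; case: s => [|a [|b [|c [|]]]] // _.
have eqb i v : i < n -> formula n bits 10 (fun w => nth false w i == v).
  by move=> lt_i; apply: formula_eq (bit_formula lt_i) (@formula_const n bits v).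
have := formula_and (formula_and (eqb (3 * p) a ltac:(lia)) (eqb (3 * p).+1 b ltac:(lia)))
  (eqb (3 * p).+2 c ltac:(lia)).
by apply: formula_ext => w _; rewrite /sym_at !eqseq_cons andbT andbA.
Qed.

Lemma readable_const x : readable (fun=> x).
Proof. by move=> s _; apply: formula_leq (@formula_const n bits (x == s)). Qed.

Lemma is_dig_formula x : readable x -> formula n bits 68 (fun w => is_dig (x w)).
Proof. by move=> Hx; exact: formula_or (Hx (sym_d false) erefl) (Hx (sym_d true) erefl). Qed.

(** One step of [scan_at_neg] costs 32 + 68 gates for the symbol tests, 1 for the conjunction and 4
    for the disjunction. *)
Lemma neg_formula t : t <= m -> formula n bits (105 * t + 1) (fun w => s_neg (st w t)).
Proof.
elim: t => [|t IHt] lt_t; first exact: (@formula_const n bits).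
have Hs := readable_sym lt_t.
have := formula_or (Hs sym_neg erefl) (formula_and (is_dig_formula Hs) (IHt (ltnW lt_t))).
move/(formula_leq (s' := 105 * t.+1 + 1)) => H; have {}H := H ltac:(lia).
by apply: formula_ext H => w _; rewrite scan_at_neg.
Qed.

Lemma cur_lits_formula l t : t <= m ->
  formula n bits (t * (300 * m.+1) + 1) (fun w => l \in cur_lits (sym_at w) t).
Proof.
elim: t => [|t IHt] lt_t; first exact: (@formula_const n bits).
have Hs := readable_sym lt_t.
have Hl : formula n bits (210 * t + 16) (fun w => l == (t.+1, ~~ s_neg (st w t))).
  have := formula_and (@formula_const n bits (l.1 == t.+1))
    (formula_eq (@formula_const n bits l.2) (formula_not (neg_formula (ltnW lt_t)))).
  move/(formula_leq (s' := 210 * t + 16)) => H; have {}H := H ltac:(lia).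
  by apply: formula_ext H => w _; rewrite -xpair_eqE -surjective_pairing.
have := formula_and (formula_not (Hs sym_endcl erefl))
  (formula_or (formula_and (Hs sym_endlit erefl) Hl) (IHt (ltnW lt_t))).
move/(formula_leq (s' := t.+1 * (300 * m.+1) + 1)) => H.
have {}H := H ltac:(rewrite mulSn; lia).
apply: formula_ext H => w _; rewrite /cur_lits scan_at_cur.
case: ifP => //= _; case: ifP => //= _.
by rewrite map_rcons mem_rcons inE.
Qed.

(** Walk left from both positions in parallel: the pending strings agree if both symbols are equal
    digits and the shorter strings agree, or if neither symbol is a digit. The single recursive call
    sits in a branch, so the cost is linear. *)
Lemma same_digits_formula p q : p <= m -> q <= m ->
  formula n bits (p * 500 + 70) (fun w => s_dig (st w p) == s_dig (st w q)).
Proof.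
elim: p q => [|p IHp] [|q] le_p le_q; first by apply: formula_leq (@formula_const n bits true).
- have := formula_not (is_dig_formula (readable_sym le_q)).
  move/(formula_leq (s' := 0 * 500 + 70)) => H; have {}H := H ltac:(lia).
  apply: formula_ext H => w _; rewrite scan_at_dig.
  by case: ifP => // _; case: (s_dig (st w q)).
- have := formula_not (is_dig_formula (readable_sym le_p)).
  move/(formula_leq (s' := p.+1 * 500 + 70)) => H; have {}H := H ltac:(lia).
  apply: formula_ext H => w _; rewrite scan_at_dig.
  by case: ifP => // _; case: (s_dig (st w p)).
have [Hp Hq] := (readable_sym le_p, readable_sym le_q).
have := formula_if (is_dig_formula Hp)
  (formula_if (is_dig_formula Hq)
    (formula_and (formula_eq (Hp (sym_d true) erefl) (Hq (sym_d true) erefl))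
       (IHp q (ltnW le_p) (ltnW le_q)))
    (@formula_const n bits false))
  (formula_not (is_dig_formula Hq)).
move/(formula_leq (s' := p.+1 * 500 + 70)) => H; have {}H := H ltac:(lia).
apply: formula_ext H => w _; rewrite !scan_at_dig.
case: ifP => _; case: ifP => _ //.
- by rewrite eqseq_rcons andbC.
- by case: (s_dig _).
- by case: (s_dig _).
Qed.

Lemma same_lits_formula e c : e <= m ->
  formula n bits (same_cost m) (fun w => same_lits m (cur_lits (sym_at w) e) c).
Proof.
move=> le_e; have le_mem : e * (300 * m.+1) + 1 <= mem_cost m.
  by rewrite leq_add2r leq_mul2r le_e orbT.
have H l : l \in lits_upto m ->
    formula n bits (2 * mem_cost m + 10) (fun w => (l \in cur_lits (sym_at w) e) == (l \in c)).
  move=> _; have := formula_eq (cur_lits_formula l le_e) (@formula_const n bits (l \in c)).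
  by apply: formula_leq; lia.
apply: formula_leq (formula_all H).
by rewrite size_allpairs size_iota /same_cost addn1 -addnS (mulnC m).
Qed.

Lemma selected_formula i :
  formula n bits (selected_cost m) (fun w => selected (sym_at w) m al i).
Proof.
have H1 e : e \in iota 0 m -> formula n bits (same_cost m + 33)
    (fun w => (sym_at w e == sym_endcl) && same_lits m (cur_lits (sym_at w) e) (al i)).
  rewrite mem_iota => /= lt_e.
  have := formula_and (readable_sym lt_e (s := sym_endcl) erefl)
    (same_lits_formula (al i) (ltnW lt_e)).
  by apply: formula_leq; lia.
have H2 pq : pq \in positions2 m -> formula n bits (m * 500 + 72)
    (fun w => same_lits m (link pq) (al i) && (s_dig (st w pq.1) == s_dig (st w pq.2))).
  case/allpairsP=> -[p q] /= []; rewrite !mem_iota /= => lt_p lt_q ->.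
  have := formula_and (@formula_const n bits (same_lits m (link (p, q)) (al i)))
    (same_digits_formula (ltnW lt_p) (ltnW lt_q)).
  by apply: formula_leq; lia.
apply: formula_leq (formula_or (formula_has H1) (formula_has H2)).
rewrite size_allpairs !size_iota /selected_cost.
have : m * (same_cost m + 33).+4 <= m * (same_cost m + 40) by rewrite leq_mul2l; lia.
have : m * m * (m * 500 + 72).+4 <= m * m * (m * 500 + 100) by rewrite leq_mul2l; lia.
by lia.
Qed.

Lemma clauses_short_formula :
  formula n bits (short_cost m) (fun w => clauses_short (sym_at w) m al).
Proof.
have H e : e \in iota 0 m -> formula n bits (dd m * (same_cost m + 4) + 49)
    (fun w => (sym_at w e != sym_endcl) ||
       has (fun i => same_lits m (cur_lits (sym_at w) e) (al i)) (iota 1 (dd m))).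
  rewrite mem_iota => /= lt_e.
  have := formula_or (formula_not (readable_sym lt_e (s := sym_endcl) erefl))
    (formula_has (l := iota 1 (dd m)) (fun i _ => same_lits_formula (al i) (ltnW lt_e))).
  by apply: formula_leq; rewrite size_iota -[_.+4]addn4; lia.
apply: formula_leq (formula_all H); rewrite size_iota /short_cost -[_.+1]addn1 leq_add2r.
by rewrite leq_mul2l -addnS leqnn orbT.
Qed.

(** A virtual ENDCLAUSE before the first symbol marks the start, where a new clause may begin; it
    also admits the empty formula. *)
Definition grammatical (w : seq bool) : bool :=
  path sym_ok sym_endcl (mkseq (sym_at w) m) && (last sym_endcl (mkseq (sym_at w) m) == sym_endcl).

Lemma sym_ok_formula x y : readable x -> readable y ->
  formula n bits 400 (fun w => sym_ok (x w) (y w)).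
Proof.
move=> Hx Hy; apply: formula_leq (formula_or (Hy (sym_d true) erefl)
  (formula_or (formula_and (Hy sym_neg erefl)
      (formula_or (Hx sym_endlit erefl) (Hx sym_endcl erefl)))
  (formula_or (formula_and (formula_or (Hy (sym_d false) erefl) (Hy sym_endlit erefl))
      (is_dig_formula Hx))
    (formula_and (Hy sym_endcl erefl) (Hx sym_endlit erefl))))).
by [].
Qed.

Lemma readable_prev t : t <= m ->
  readable (fun w => nth [::] (sym_endcl :: mkseq (sym_at w) m) t).
Proof.
case: t => [_|t lt_t]; first exact: readable_const.
move=> s sz_s; have := readable_sym lt_t sz_s.
by apply: formula_ext => w _; rewrite /= nth_mkseq.
Qed.

Lemma grammatical_formula : formula n bits (valid_cost m) grammatical.
Proof.
have H t : t \in iota 0 m -> formula n bits 400 (fun w =>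
    sym_ok (nth [::] (sym_endcl :: mkseq (sym_at w) m) t) (sym_at w t)).
  rewrite mem_iota => /= lt_t.
  exact: sym_ok_formula (readable_prev (ltnW lt_t)) (readable_sym lt_t).
have := formula_and (formula_all H) (readable_prev (leqnn m) (s := sym_endcl) erefl).
move/(formula_leq (s' := valid_cost m)) => {}H.
have {}H := H ltac:(rewrite size_iota /valid_cost; lia).
apply: formula_ext H => w _; rewrite /grammatical; congr andb; last first.
  by rewrite (last_nth [::]) size_mkseq.
apply/allP/(pathP [::]) => [H t|H t].
  rewrite size_mkseq => lt_t; have := H t; rewrite mem_iota => /(_ lt_t).
  by rewrite nth_mkseq.
by rewrite mem_iota => /= lt_t; have := H t; rewrite size_mkseq nth_mkseq // => ->.
Qed.

End ParserCircuit.

Section Decide.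
Variables (alphas : nat -> nat -> seq lit) (m : nat).
Hypothesis al_bij : alpha_bij m (alphas m).

Definition selection (w : seq bool) : seq bool :=
  mkseq (fun j => selected (sym_at w) m (alphas m) j.+1) (dd m).

Lemma threeSATC_selection w :
  threeSATC alphas (dd m) (selection w) <->
  satisfiable [seq alphas m i | i <- iota 1 (dd m) & selected (sym_at w) m (alphas m) i].
Proof.
have -> : [seq i <- iota 1 (dd m) | selected (sym_at w) m (alphas m) i]
  = [seq i <- iota 1 (dd m) | nth false (selection w) i.-1].
  apply/eq_in_filter => i; rewrite mem_iota => i_in.
  by rewrite nth_mkseq; [case: i i_in | lia].
(* Length dd m belongs to the index m, so the selection has one bit per clause and no padding. *)
have here : dd m <= dd m < dd m.+1 by rewrite leqnn ddS.
split=> [[k [k_in sat]]|sat]; last by exists m.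
by rewrite (dd_interval_uniq here k_in).
Qed.

Lemma threeSAT_selection w : size w = 3 * m ->
  threeSAT w <-> [/\ grammatical m w, clauses_short (sym_at w) m (alphas m) &
                    threeSATC alphas (dd m) (selection w)].
Proof.
move=> sz_w; have split3 phi : is3CNF phi = well_formed phi && all (fun c => size c <= 3) phi.
  rewrite /is3CNF /well_formed -all_predI; apply: eq_all => c /=.
  by rewrite -!andbA; congr andb; rewrite andbC.
split=> [[phi [ok_phi [/(syms_cnf_sym_at _ sz_w) E sat]]]|[gr short sat]].
  move: ok_phi; rewrite split3 => /andP[wf short]; split.
  - by rewrite /grammatical -E sym_ok_cnf.
  - by rewrite (clauses_shortP al_bij (esym E) wf).
  - by apply/threeSATC_selection/(selected_satisfiable al_bij (esym E) wf short).
have [path_ok /eqP last_ok] := andP gr.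
have [/(_ erefl)[phi wf E] _ _ _] := sym_ok_decode path_ok last_ok.
exists phi; move: short; rewrite split3 wf (clauses_shortP al_bij E wf) => short; split=> //.
split; first exact/(syms_cnf_sym_at _ sz_w).
by move/threeSATC_selection: sat => /(selected_satisfiable al_bij E wf short).
Qed.

(** The selection formulas take the place of the input registers and are rebuilt at every read. The
    last three gates are two conjunctions and the copy of the output. *)
Lemma decide_circuit X : IS_br X -> IS_computes (dd m) X (threeSATC alphas (dd m)) ->
  exists gs, [/\ circuit_ok (3 * m) gs,
    size gs <= valid_cost m + short_cost m
      + (size X).+1 * ((2 * size X).+1 * (2 * (selected_cost m).+1 + 20)) + 3 &
    forall w, size w = 3 * m -> circ_eval gs w = true <-> threeSAT w].
Proof.
case/andP=> _ br_X X_P.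
(* Same shift and default as in [init_regs]; an index beyond the selection gives the constant F. *)
pose x j w := nth false (selection w) j.-1.
have x_formula j : formula (3 * m) (input_bit (3 * m)) (selected_cost m).+1 (x j).
  rewrite /x; have [lt_j|le_j] := ltnP j.-1 (dd m).
    have := formula_leq (leqnSn _) (@selected_formula m (alphas m) j.-1.+1).
    by apply: formula_ext => w _; rewrite nth_mkseq.
  have := formula_leq (isT : 0 < (selected_cost m).+1)
    (@formula_const (3 * m) (input_bit (3 * m)) false).
  apply: formula_ext => w _.
  by rewrite nth_default // size_mkseq.
have [gs [ok sz Egs]] := circuit_of_builds (formula_and
  (formula_and (@grammatical_formula m) (@clauses_short_formula m (alphas m)))
  (@sweep_formula _ _ _ _ X x_formula)).
exists gs; split=> // [|w sz_w]; first by apply: leq_trans sz _; rewrite /stage_cost; lia.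
rewrite Egs // threeSAT_selection //.
have [T [r [Hrun Hr]]] := X_P (selection w) (size_mkseq _ _).
rewrite -(sweep_computes br_X Hrun) in Hr.
by split=> [/andP[/andP[-> ->] /Hr]|[-> -> /Hr]].
Qed.

End Decide.

Lemma poly_bounded_succ f : poly_bounded f -> poly_bounded (fun n => (f n).+1).
Proof.
move=> Hf; apply: (@poly_bounded_leq _ (fun n => f n + 1)) => [n|]; first by rewrite addn1.
by apply: poly_bounded_add => //; apply: poly_bounded_const.
Qed.

Lemma P_poly_of_P_lis (alphas : nat -> nat -> seq lit) :
  (forall k, alpha_bij k (alphas k)) -> P_lis (threeSATC alphas) -> P_poly threeSAT.
Proof.
move=> al_bij [c Hc]; pose L m := c * dd m ^ c + c.
pose sz m := valid_cost m + short_cost m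
  + (L m).+1 * ((2 * L m).+1 * (2 * (selected_cost m).+1 + 20)) + 3.
have [C HC] : exists C, forall m, sz m <= C * m ^ C + C.
  apply/poly_boundedP; rewrite /sz /valid_cost /short_cost /selected_cost /same_cost /mem_cost /L.
  by repeat (first [exact: poly_bounded_const | exact: poly_bounded_dd | exact: poly_bounded_id
    | apply: poly_bounded_add | apply: poly_bounded_mul | apply: poly_bounded_succ
    | apply: poly_bounded_exp]).
(* A circuit is nonempty, so even the trivial lengths need room for one gate. *)
have C_gt0 : 0 < C by case: C HC => // /(_ 0); rewrite /sz addn3.
exists C => n; have [/dvdnP[m En]|not3] := boolP (3 %| n); last first.
  (* Symbols have three bits, so no code has this length and the constant F decides it. *)
  exists [:: GConst false]; split=> //; split=> [|b sz_b]; first exact: leq_trans C_gt0 (leq_addl _ _).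
  rewrite /circ_eval /= last_rcons; split=> // -[phi [_ [E _]]]; case/negP: not3.
  rewrite -sz_b -E -flatten_syms_cnf size_flatten.
  have := @size_syms_cnf phi; elim: (syms_cnf phi) => //= x ss IHss Hss.
  rewrite Hss ?mem_head // dvdn_addr //; apply: IHss => y y_ss.
  by apply: Hss; rewrite inE y_ss orbT.
have [X [X_br [X_sz X_P]]] := Hc (dd m).
have [gs [gs_ok gs_sz gs_P]] := decide_circuit (al_bij m) X_br X_P.
have En' : n = 3 * m by rewrite En mulnC.
exists gs; rewrite En'; split=> //; split=> //.
apply: leq_trans gs_sz _; apply: (@leq_trans (sz m)).
  by rewrite leq_add2r leq_add2l !leq_mul // ltnS leq_mul2l.
apply: leq_trans (HC m) _; rewrite leq_add2r leq_mul //.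
by case: (C) => // C'; rewrite leq_exp2r // leq_pmull.
Qed.

Theorem theorem8 (alphas : nat -> nat -> seq lit)
  (Hbij : forall k, alpha_bij k (alphas k))
  (Hcons : alpha_consistent alphas)
  (Hpoly : alpha_polytime alphas) :
  ~ P_lis (threeSATC alphas) <-> ~ P_poly threeSAT.
Proof.
split; apply: contra_not; last exact: P_poly_of_P_lis.
by apply: P_lis_of_P_poly => k j; case: (Hbij k) => H _; apply: H.
Qed.
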